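(* Let $E$ be an infinite-dimensional Banach space with an unconditional basis and with an equivalent norm that is $C^1$ (away from the origin) and locally depends on finitely many coordinates. Let $U$ be an open subset of $E$, $f:U\to\mathbb{R}^d$ a $C^1$ function and $\varepsilon:U\to(0,\infty)$ a continuous function. Then there exists a $C^1$ function $g:U\to\mathbb{R}^d$ such that: (1) $\|f(x)-g(x)\|\leq\varepsilon(x)$ for every $x\in U$; (2) $\|Df(x)-Dg(x)\|\leq\varepsilon(x)$ for every $x\in U$; (3) $Dg(x)$ is surjective for every $x\in U$, i.e. $g$ has no critical points.
   Context: A norm $\|\cdot\|$ on $E$ locally depends on finitely many coordinates if for every $x\in E$ there exist a natural number $l_x$, an open neighbourhood $U_x$ of $x$, functionals $L_1,\dots,L_{l_x}\in E^*$ and a function $\gamma:\mathbb{R}^{l_x}\to\mathbb{R}$ such that $\|y\|=\gamma(L_1(y),\dots,L_{l_x}(y))$ for every $y\in U_x$. The norm on $\mathbb{R}^d$ is Euclidean; norms of linear maps are operator norms. *)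

(* Defs.v *)
From HB Require Import structures.
From mathcomp Require Import all_boot all_order all_algebra.
From mathcomp Require Import all_classical all_reals all_analysis.
Set Implicit Arguments. Unset Strict Implicit. Unset Printing Implicit Defensive.
Import Order.TTheory GRing.Theory Num.Theory.
Import numFieldNormedType.Exports.
Local Open Scope classical_set_scope.
Local Open Scope ring_scope.

Definition enorm (R : realType) (d : nat) (v : 'rV[R]_d) : R :=
  Num.sqrt (\sum_(i < d) (v ord0 i) ^+ 2).

Definition schauder_basis (R : realType) (E : normedModType R) (e : nat -> E) :=
  forall x : E, exists! a : nat -> R,
    series (fun n => a n *: e n) @ \oo --> x.

Definition unconditional_basis (R : realType) (E : normedModType R)
    (e : nat -> E) :=
  schauder_basis e /\
  forall (x : E) (a : nat -> R), series (fun n => a n *: e n) @ \oo --> x ->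
    forall s : nat -> nat, bijective s ->
      series (fun n => a (s n) *: e (s n)) @ \oo --> x.

Definition equivalent_norm (R : realType) (E : normedModType R) (N : E -> R) :=
  [/\ forall x y : E, N (x + y) <= N x + N y,
      forall (a : R) (x : E), N (a *: x) = `|a| * N x,
      forall x : E, N x = 0 -> x = 0 &
      exists c C : R, [/\ 0 < c, 0 < C &
        forall x : E, c * `|x| <= N x /\ N x <= C * `|x|]].

Definition C1_away_origin (R : realType) (E : normedModType R) (N : E -> R) :=
  forall x : E, x != 0 ->
    differentiable N x /\
    forall e : R, 0 < e -> \forall y \near x,
      forall h : E, `|'d N y h - 'd N x h| <= e * `|h|.

Definition locally_finitely_many_coords (R : realType) (E : normedModType R)
    (N : E -> R) :=
  forall x : E, x != 0 ->
    exists (l : nat) (V : set E) (L : 'I_l -> E -> R) (gamma : ('I_l -> R) -> R),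
      [/\ open V, V x,
          forall i, (forall (a : R) (u v : E), L i (a *: u + v) = a * L i u + L i v)
                    /\ continuous (L i) &
          forall y, V y -> N y = gamma (fun i => L i y)].

Definition C1_on (R : realType) (E : normedModType R) (d : nat) (U : set E)
    (f : E -> 'rV[R]_d) :=
  forall x : E, U x ->
    differentiable f x /\
    forall e : R, 0 < e -> \forall y \near x,
      forall h : E, enorm ('d f y h - 'd f x h) <= e * `|h|.

(* Main.v *)
Require Import Defs.
From HB Require Import structures.
From mathcomp Require Import all_boot all_order all_algebra.
From mathcomp Require Import ring lra.
From mathcomp Require Import all_classical all_reals all_analysis.
Import Order.TTheory GRing.Theory Num.Theory.
Import numFieldNormedType.Exports.
Local Open Scope classical_set_scope.
Local Open Scope ring_scope.

(** Write [beta z] for a C^1 cut-off of the norm: [0] near the origin, [1] far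
    away, depending locally on finitely many functionals.  The map
    [Psi x = \sum_k beta (tail_k x) x_k e_k] is locally of finite rank, stays at
    bounded distance from the identity, and has bounded derivative: the terms
    containing the derivative of [beta] form a multiplier acting on a tail of
    bounded norm, which unconditionality controls.  Rescaling gives
    [Psi_t x = t Psi (x / t)], uniformly close to the identity with the same
    derivative bound.  On a small ball with centre [q], where [Df] is nearly
    [A = Df(q)], the function [A + (f - A) \o Psi_t] is C^1-close to [f] and
    depends locally on finitely many functionals.  Gluing such functions with a
    partition of unity made of translates of [beta] yields a fine approximation
    of [f] that locally uses only finitely many functionals of a countable
    family [F].  Some bounded linear map [T : E -> R^d] maps the common kernel of
    any finitely many elements of [F] onto [R^d].  After adding a small positive
    multiple of [T] to each patch, the derivative in the direction of a vector of
    such a kernel is a positive multiple of [T], hence it is onto. *)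

(** * Strict derivatives *)

(** The obstacle is that the derivative of [Psi_t] is bounded by a constant [kap] but is not close
    to the identity, so composing [f] itself with [Psi_t] would spoil its derivative. Subtracting
    [A] cures this: on a small ball the derivative of [f - A] is a small multiple of the tolerance,
    which a factor [kap] cannot ruin, and the linear map [A] costs only [d] more functionals.
    Shrinking [t] does not change the derivative bound but brings the patch as close to [f] as
    desired. This freedom pays for the Lipschitz constants of the partition of unity, which grow
    without control from patch to patch. The order of choices matters. The family [F] consists of
    the coordinates of the basis, the functionals of [beta] and the components of the maps [A];
    common kernels are subspaces, so [F] serves every scale [t]. Only afterwards is [T] built from
    [F], and the scales and the multiples of [T] come last. *)

Section near2.
Set Implicit Arguments. Unset Strict Implicit.
Context {R : realType} {V : normedModType R}.
Implicit Types (x : V) (P Q : V -> V -> Prop).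

Definition near2 x P := exists2 r : R, 0 < r &
  forall y z, `|y - x| < r -> `|z - x| < r -> P y z.

Lemma near2S x P Q : (forall y z, P y z -> Q y z) -> near2 x P -> near2 x Q.
Proof. by move=> PQ [r r0 h]; exists r => // y z ? ?; apply/PQ/h. Qed.

Lemma near2I x P Q : near2 x P -> near2 x Q -> near2 x (fun y z => P y z /\ Q y z).
Proof.
move=> [r r0 hr] [s s0 hs]; exists (Num.min r s); first by rewrite lt_min r0.
move=> y z; rewrite !lt_min => /andP[? ?] /andP[? ?].
by split; [apply: hr|apply: hs].
Qed.

Lemma near_ballP x (P : V -> Prop) : (\forall y \near x, P y) <->
  exists2 r : R, 0 < r & forall y, `|y - x| < r -> P y.
Proof.
split=> [/nbhs_ballP[r /= r0 h]|[r r0 h]].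
  by exists r => // y yx; apply: h; rewrite -ball_normE /= distrC.
by apply/nbhs_ballP; exists r => //= y; rewrite -ball_normE /= distrC; apply: h.
Qed.

Lemma near2_nbhs x (P : V -> Prop) :
  (\forall y \near x, P y) -> near2 x (fun y z => P y /\ P z).
Proof. by move=> /near_ballP[r r0 h]; exists r => // y z ? ?; split; apply: h. Qed.

End near2.

Section bounded_linear.
Set Implicit Arguments. Unset Strict Implicit.
Context {R : realType} {V W : normedModType R}.
Implicit Types A B : V -> W.

(** A predicate on plain functions: derivatives arise below as explicit sums, products and
    composites, and no linear structure has to be packed for each of them. *)
Definition blin A := (forall a u v, A (a *: u + v) = a *: A u + A v) /\
  exists2 M : R, 0 <= M & forall h, `|A h| <= M * `|h|.

Lemma blinD A u v : blin A -> A (u + v) = A u + A v.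
Proof. by case=> /(_ 1 u v); rewrite !scale1r. Qed.

Lemma blin0 A : blin A -> A 0 = 0.
Proof. by move=> bA; apply: (addrI (A 0)); rewrite addr0 -blinD // addr0. Qed.

Lemma blinZ A a u : blin A -> A (a *: u) = a *: A u.
Proof. by move=> bA; have := bA.1 a u 0; rewrite blin0 // !addr0. Qed.

Lemma blinN A u : blin A -> A (- u) = - A u.
Proof. by move=> bA; rewrite -scaleN1r blinZ // scaleN1r. Qed.

Lemma blinB A u v : blin A -> A (u - v) = A u - A v.
Proof. by move=> bA; rewrite blinD // blinN. Qed.

Lemma blin_eq A B : A =1 B -> blin A -> blin B.
Proof. by move=> /funext ->. Qed.

Lemma blin_cst0 : blin (fun=> 0).
Proof.
split=> [a u v|]; first by rewrite scaler0 addr0.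
by exists 0 => // h; rewrite normr0 mul0r.
Qed.

Lemma blin_add A B : blin A -> blin B -> blin (fun h => A h + B h).
Proof.
move=> [lA [M M0 bA]] [lB [M' M'0 bB]]; split=> [a u v|].
  by rewrite lA lB scalerDr addrACA.
exists (M + M') => [|h]; first exact: addr_ge0.
by rewrite mulrDl (le_trans (ler_normD _ _)) // lerD.
Qed.

Lemma blin_scale A (c : R) : blin A -> blin (fun h => c *: A h).
Proof.
move=> [lA [M M0 bA]]; split=> [a u v|].
  by rewrite lA scalerDr !scalerA mulrC.
exists (`|c| * M) => [|h]; first exact: mulr_ge0.
by rewrite normrZ -mulrA ler_wpM2l.
Qed.

Lemma blin_opp A : blin A -> blin (fun h => - A h).
Proof. by move=> /(@blin_scale A (-1)); apply: blin_eq => h; rewrite scaleN1r. Qed.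

End bounded_linear.

Section strict_derivative.
Set Implicit Arguments. Unset Strict Implicit.
Context {R : realType}.
Implicit Types U V W : normedModType R.

Lemma blin_scalel V W (a : V -> R) (w : W) :
  blin a -> blin (fun h => a h *: w).
Proof.
move=> [la [M M0 ba]]; split=> [c u v|]; first by rewrite la scalerDl scalerA.
exists (M * `|w|) => [|h]; first exact: mulr_ge0.
by rewrite normrZ mulrAC ler_wpM2r.
Qed.

Lemma blin_comp U V W (A : V -> W) (B : U -> V) :
  blin A -> blin B -> blin (fun h => A (B h)).
Proof.
move=> [lA [M M0 bA]] [lB [M' M'0 bB]]; split=> [c u v|]; first by rewrite lB lA.
exists (M * M') => [|h]; first exact: mulr_ge0.
by rewrite (le_trans (bA _)) // -mulrA ler_wpM2l.
Qed.

Lemma blin_sum V W n (A : nat -> V -> W) :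
  (forall k, (k < n)%N -> blin (A k)) -> blin (fun h => \sum_(k < n) A k h).
Proof.
elim: n => [|n ih] h.
  by apply: blin_eq blin_cst0 => u; rewrite big_ord0.
apply: blin_eq (blin_add (ih _) (h n _)) => // [u|k kn].
  by rewrite big_ord_recr.
by apply: h; rewrite ltnS ltnW.
Qed.

Lemma blin_id V : blin (@id V).
Proof. by split=> //; exists 1 => // h; rewrite mul1r. Qed.

Lemma blin_linear V W (A : {linear V -> W}) : continuous A -> blin A.
Proof.
move=> cA; split=> [a u v|]; first by rewrite linearP.
by have [k k0 h] := linear_lipschitz cA; exists k => //; exact: ltW.
Qed.

Lemma blin_diff V W (f : V -> W) x : differentiable f x -> blin ('d f x).
Proof. by move=> /diff_continuous /blin_linear. Qed.

(* Strict differentiability: unlike Frechet differentiability, holding at every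
   point of an open set it amounts to being C^1 there, and no nearby derivative
   has to be mentioned. *)
Definition sder V W (f : V -> W) (x : V) (A : V -> W) := blin A /\
  forall e : R, 0 < e ->
    near2 x (fun y z => `|f y - f z - A (y - z)| <= e * `|y - z|).

Lemma sder_near_eq V W (f g : V -> W) x A :
  (\forall y \near x, f y = g y) -> sder f x A -> sder g x A.
Proof.
move=> fg [lA h]; split=> // e e0.
apply: near2S (near2I (near2_nbhs fg) (h e e0)) => y z [[-> ->]].
exact.
Qed.

Lemma sder_lin V W (f : V -> W) x : blin f -> sder f x f.
Proof.
move=> lf; split=> // e e0; exists 1 => // y z _ _.
by rewrite (blinB _ _ lf) subrr normr0 mulr_ge0 // ltW.
Qed.

Lemma sder_cst V W (w : W) (x : V) : sder (fun=> w) x (fun=> 0).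
Proof.
split; first exact: blin_cst0.
by move=> e e0; exists 1 => // y z _ _; rewrite !subr0 subrr normr0 mulr_ge0 // ltW.
Qed.

Lemma sder_eqd V W (f : V -> W) x A B : A =1 B -> sder f x A -> sder f x B.
Proof. by move=> /funext ->. Qed.

Lemma sder_eqf V W (f g : V -> W) x A : f =1 g -> sder f x A -> sder g x A.
Proof. by move=> /funext ->. Qed.

Lemma sderD V W (f g : V -> W) x A B : sder f x A -> sder g x B ->
  sder (fun y => f y + g y) x (fun h => A h + B h).
Proof.
move=> [lA hA] [lB hB]; split=> [|e e0]; first exact: blin_add.
have e2 : 0 < e / 2 by rewrite divr_gt0.
apply: near2S (near2I (hA _ e2) (hB _ e2)) => y z [h1 h2].
rewrite (_ : _ - _ - _ = (f y - f z - A (y - z)) + (g y - g z - B (y - z))).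
  by rewrite (splitr e) mulrDl (le_trans (ler_normD _ _)) // lerD.
by rewrite !opprD (addrACA (f y)) (addrACA (f y - f z)).
Qed.

Lemma sder_scale V W (f : V -> W) (c : R) x A : sder f x A ->
  sder (fun y => c *: f y) x (fun h => c *: A h).
Proof.
move=> [lA hA]; split=> [|e e0]; first exact: blin_scale.
have e2 : 0 < e / (1 + `|c|) by rewrite divr_gt0 // ltr_wpDr.
apply: near2S (hA _ e2) => y z h1.
rewrite -!scalerBr normrZ (le_trans (ler_wpM2l _ h1)) //.
rewrite mulrA ler_wpM2r // mulrCA ler_piMr ?(ltW e0) //.
by rewrite ler_pdivrMr ?ltr_wpDr // mul1r lerDr.
Qed.

Lemma sderN V W (f : V -> W) x A : sder f x A ->
  sder (fun y => - f y) x (fun h => - A h).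
Proof.
move=> /(sder_scale (-1)) h.
by apply: sder_eqf (sder_eqd _ h) => u; rewrite scaleN1r.
Qed.

Lemma sderB V W (f g : V -> W) x A B : sder f x A -> sder g x B ->
  sder (fun y => f y - g y) x (fun h => A h - B h).
Proof. by move=> hA /sderN; apply: sderD. Qed.

Lemma sder_sum V W n (f : nat -> V -> W) x (A : nat -> V -> W) :
  (forall k, (k < n)%N -> sder (f k) x (A k)) ->
  sder (fun y => \sum_(k < n) f k y) x (fun h => \sum_(k < n) A k h).
Proof.
elim: n => [|n ih] h.
  apply: sder_eqf (sder_eqd _ (sder_cst 0 x)) => u; by rewrite big_ord0.
apply: (@sder_eqf _ _ (fun y => \sum_(k < n) f k y + f n y)).
  by move=> u; rewrite big_ord_recr.
apply: (@sder_eqd _ _ _ _ (fun y => \sum_(k < n) A k y + A n y)).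
  by move=> u; rewrite big_ord_recr.
by apply: sderD; [apply: ih => k kn; apply: h; rewrite ltnS ltnW|apply: h].
Qed.

Lemma sder_lip V W (f : V -> W) x A : sder f x A -> exists2 L : R, 0 < L &
  near2 x (fun y z => `|f y - f z| <= L * `|y - z|).
Proof.
move=> [[lA [M M0 bA]] hA]; exists (M + 1); first by rewrite ltr_wpDl.
apply: near2S (hA 1 ltr01) => y z h.
rewrite -(subrK (A (y - z)) (f y - f z)) (le_trans (ler_normD _ _)) //.
by rewrite addrC mulrDl lerD.
Qed.

Lemma lip_near V W (f : V -> W) x (L : R) : 0 < L ->
  near2 x (fun y z => `|f y - f z| <= L * `|y - z|) ->
  forall e : R, 0 < e -> \forall y \near x, `|f y - f x| < e.
Proof.
move=> L0 [r r0 h] e e0; apply/near_ballP.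
exists (Num.min r (e / L)); first by rewrite lt_min r0 divr_gt0.
move=> y; rewrite lt_min => /andP[yr ye].
rewrite (le_lt_trans (h _ _ yr _)) ?subrr ?normr0 //.
by rewrite mulrC -ltr_pdivlMr.
Qed.

Lemma sder_near V W (f : V -> W) x A : sder f x A ->
  forall e : R, 0 < e -> \forall y \near x, `|f y - f x| < e.
Proof. by move=> /sder_lip[L L0]; apply: lip_near. Qed.

(** Test the derivative on a multiple of [h] of length [r / 2] and use homogeneity. Derivative
    bounds for [beta] and for the partition of unity come from their Lipschitz constants in this
    way. *)
Lemma sder_bound V W (f : V -> W) x A (L : R) : sder f x A -> 0 <= L ->
  near2 x (fun y z => `|f y - f z| <= L * `|y - z|) ->
  forall h, `|A h| <= L * `|h|.
Proof.
move=> [lA hA] L0 hL h.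
apply/ler_addgt0Pr => e e0.
have [->|h0] := eqVneq h 0; first by rewrite (blin0 lA) !normr0 mulr0 add0r ltW.
have h1 : 0 < `|h| by rewrite normr_gt0.
have e1 : 0 < e / `|h| by rewrite divr_gt0.
have [r r0 hr] := near2I (hA _ e1) hL.
pose t := r / 2 / `|h|.
have t0 : 0 < t by rewrite !divr_gt0.
have nt : `|t *: h| = r / 2 by rewrite normrZ gtr0_norm // divfK // gt_eqF.
have r2 : r / 2 < r by rewrite ltr_pdivrMr // ltr_pMr // ltr1n.
have := hr (t *: h + x) x; rewrite addrK subrr normr0 nt => /(_ r2 r0)[h3 h4].
have : `|A (t *: h)| <= (L + e / `|h|) * (r / 2).
  rewrite -[A _](subrK (f (t *: h + x) - f x)) (le_trans (ler_normD _ _)) //.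
  by rewrite distrC mulrDl addrC lerD.
rewrite (blinZ _ _ lA) normrZ gtr0_norm // -nt normrZ gtr0_norm // mulrCA ler_pM2l //.
by rewrite mulrDl divfK // gt_eqF.
Qed.

Lemma sderZ V W (a : V -> R) (f : V -> W) x A B : sder a x A -> sder f x B ->
  sder (fun y => a y *: f y) x (fun h => A h *: f x + a x *: B h).
Proof.
move=> sa sf.
have [lA hA] := sa; have [lB hB] := sf; split=> [|e e0].
  by apply: blin_add; [exact: blin_scalel|exact: blin_scale].
have [_ [M M0 bA]] := lA.
have [L L0 hL] := sder_lip sf.
have e4 : 0 < e / 4 by rewrite divr_gt0.
pose c := `|f x| + 1; pose c' := `|a x| + 1.
have c0 : 0 < c by rewrite ltr_wpDl.
have c'0 : 0 < c' by rewrite ltr_wpDl.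
have e1 : 0 < e / 4 / c by rewrite divr_gt0.
have e2 : 0 < e / 4 / (M + 1) by rewrite divr_gt0 // ltr_wpDl.
have e3 : 0 < e / 4 / L by rewrite divr_gt0.
have e5 : 0 < e / 4 / c' by rewrite divr_gt0.
apply: near2S (near2I (near2I (hA _ e1) (hB _ e5)) (near2I hL (near2I
  (near2_nbhs (sder_near sf ltr01)) (near2I
  (near2_nbhs (sder_near sf e2)) (near2_nbhs (sder_near sa e3)))))).
move=> y z [[h1 h2] [h3 [[h4 _] [[h5 _] [_ h6]]]]].
pose w := y - z.
(* Each of the four terms of this Leibniz remainder is a product of a small factor and a bounded
   one. *)
have -> : a y *: f y - a z *: f z - (A w *: f x + a x *: B w) =
  (a y - a z - A w) *: f y + A w *: (f y - f x)
  + ((a z - a x) *: (f y - f z) + a x *: (f y - f z - B w)).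
  have q1 : (a y - a z - A w) *: f y + A w *: (f y - f x) =
      a y *: f y - a z *: f y - A w *: f x.
    by rewrite !scalerBl scalerBr addrA subrK.
  have q2 : (a z - a x) *: (f y - f z) + a x *: (f y - f z - B w) =
      a z *: f y - a z *: f z - a x *: B w.
    by rewrite !scalerBl (scalerBr _ (f y - f z)) addrA subrK scalerBr.
  rewrite q1 q2 opprD !addrA; congr (_ - _).
  rewrite -!addrA; congr (_ + _).
  by rewrite [- (A w *: _) + _]addrC !addrA addNr add0r.
have fy : `|f y| <= c.
  by rewrite /c -[f y](subrK (f x)) (le_trans (ler_normD _ _)) // addrC lerD // ltW.
(* Every term gets [e / 4]. The second has the fraction [M / (M + 1)] of it, as [M] may be 0, and
   the last summand is the slack. *)
have -> : e * `|y - z| = (e / 4 / c * `|w|) * c + (M * `|w|) * (e / 4 / (M + 1)) +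
   (e / 4 / L * (L * `|w|) + c' * (e / 4 / c' * `|w|)) + e / 4 / (M + 1) * `|w|.
  by rewrite /w; field; rewrite !gt_eqF // ltr_wpDl.
apply: ler_wpDr; first by rewrite mulr_ge0 // ltW.
rewrite (le_trans (ler_normD _ _)) // lerD // (le_trans (ler_normD _ _)) // lerD //.
- by rewrite normrZ ler_pM.
- by rewrite normrZ ler_pM // ltW.
- by rewrite normrZ ler_pM // ltW.
- by rewrite normrZ ler_pM // lerDl.
Qed.

Lemma sder_comp U V W (f : U -> V) (g : V -> W) x A B :
  sder f x A -> sder g (f x) B -> sder (fun y => g (f y)) x (fun h => B (A h)).
Proof.
move=> sf [lB hB]; have [lA hA] := sf; split=> [|e e0]; first exact: blin_comp.
have [_ [M M0 bB]] := lB.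
have [L L0 hL] := sder_lip sf.
have e1 : 0 < e / 2 / L by rewrite !divr_gt0.
have e2 : 0 < e / 2 / (M + 1) by rewrite !divr_gt0 // ltr_wpDl.
have [r r0 hr] := hB _ e1.
apply: near2S (near2I (near2_nbhs (sder_near sf r0)) (near2I hL (hA _ e2))).
move=> y z [[h1 h2] [h3 h4]].
rewrite -(subrK (B (f y - f z)) (g (f y) - g (f z))) -addrA -(blinB _ _ lB).
rewrite (le_trans (ler_normD _ _)) //.
have -> : e * `|y - z| = e / 2 / L * (L * `|y - z|) + M * (e / 2 / (M + 1) * `|y - z|)
  + e / 2 / (M + 1) * `|y - z|.
  by field; rewrite !gt_eqF // ltr_wpDl.
apply: ler_wpDr; first by rewrite mulr_ge0 // ltW.
rewrite lerD //.
  by apply: le_trans (hr _ _ h1 h2) _; rewrite ler_wpM2l // ltW.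
by apply: le_trans (bB _) _; rewrite ler_wpM2l.
Qed.

End strict_derivative.

(** * Strict derivatives against Frechet derivatives, and mean value inequalities *)

Section differentiability.
Set Implicit Arguments. Unset Strict Implicit.
Context {R : realType}.
Implicit Types V W : normedModType R.

Lemma blin_continuous V W (A : V -> W) : blin A -> continuous A.
Proof.
move=> bA x; have [lA [M M0 hA]] := bA.
apply/cvgrPdist_lt => e e0; apply/near_ballP.
exists (e / (M + 1)); first by rewrite divr_gt0 // ltr_wpDl.
move=> y; rewrite ltr_pdivlMr ?ltr_wpDl // => yx.
rewrite -(blinB _ _ bA) (le_lt_trans (hA _)) // (le_lt_trans _ yx) //.
by rewrite distrC mulrC ler_wpM2l // lerDl.
Qed.

Lemma sder_diff V W (f : V -> W) x A : sder f x A ->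
  differentiable f x /\ 'd f x = A :> (V -> W).
Proof.
move=> [bA hA].
pose lA := GRing.isLinear.Build _ _ _ _ A bA.1.
pose L : {linear V -> W} := HB.pack A lA.
have cL : continuous L by exact: blin_continuous bA.
have oL : f \o shift x = cst (f x) + L +o_ 0 id.
  apply/eqaddoP => e e0; have [r r0 hr] := hA e e0.
  apply/near_ballP; exists r => // h; rewrite subr0 => hlt.
  have := hr (h + x) x; rewrite addrK subrr normr0 => /(_ hlt r0).
  by rewrite /= opprD addrA.
have dL := diff_unique cL oL.
by split; [apply/diff_locallyP; rewrite dL|].
Qed.

Lemma sder_unique V W (f : V -> W) x A B : sder f x A -> sder f x B -> A = B.
Proof. by move=> /sder_diff[_ <-] /sder_diff[_ <-]. Qed.

Lemma mx_norm_leP m n (M : 'M[R]_(m, n)) (e : R) : 0 <= e ->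
  (forall i j, `|M i j| <= e) -> `|M| <= e.
Proof.
move=> e0 h; rewrite /Num.Def.normr/= mx_normrE (bigmax_le _ e0) //= => -[i j] _.
Qed.

Lemma le_mx_norm m n (M : 'M[R]_(m, n)) i j : `|M i j| <= `|M|.
Proof.
by rewrite [leRHS]/Num.Def.normr/= mx_normrE; exact: (le_bigmax _ (fun ij => `|M ij.1 ij.2|) (i, j)).
Qed.

Lemma mean_value_real V (f : V -> R) (y z : V) (c e : R) :
  (forall t : R, 0 <= t <= 1 -> differentiable f (z + t *: (y - z)) /\
     `|'d f (z + t *: (y - z)) (y - z) - c| <= e) ->
  `|f y - f z - c| <= e.
Proof.
move=> h; set w := y - z in h *.
pose p (t : R) := z + t *: w.
have dp (t : R) : is_diff t p (fun s : R => s *: w).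
  have -> : p = cst z + (fun s : R => s *: w) by apply/funext.
  by apply: is_diff_eq; rewrite add0r.
have dfp (t : R) : 0 <= t <= 1 -> is_derive t 1 (f \o p) ('d f (p t) w).
  move=> t01; have [df _] := h t t01.
  have dfp : differentiable (f \o p) t by apply: differentiable_comp.
  apply: DeriveDef; first exact: diff_derivable.
  rewrite deriveE // diff_comp //.
  by rewrite /= diff_val scale1r.
have [t t01|t|c0] := @MVT R (f \o p) (fun t => 'd f (p t) w) 0 1 ltr01.
- by apply: dfp; move: t01; rewrite in_itv /= => /andP[/ltW -> /ltW].
- apply: derivable_within_continuous => s; rewrite in_itv /= => s01.
  by have [] := dfp s s01.
rewrite in_itv /= => /andP[/ltW c1 /ltW c2].
rewrite subr0 mulr1 /= /p scale0r addr0 scale1r [z + w]addrC subrK => ->.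
have [|_] := h c0; first by rewrite c1.
by rewrite -/w.
Qed.

(** The norm of row vectors is the maximum norm, so the real inequality, applied coordinate by
    coordinate, loses no constant. The assumption [0 <= e] covers [d = 0]. *)
Lemma mean_value_rV V d (f : V -> 'rV[R]_d) (y z : V) (c : 'rV[R]_d) (e : R) :
  0 <= e ->
  (forall t : R, 0 <= t <= 1 -> differentiable f (z + t *: (y - z)) /\
     `|'d f (z + t *: (y - z)) (y - z) - c| <= e) ->
  `|f y - f z - c| <= e.
Proof.
move=> e0 h; apply: mx_norm_leP => // i j; rewrite !mxE.
apply: (@mean_value_real V (fun x => f x i j)) => t t01.
have [df hd] := h t t01.
have dc (M : 'rV[R]_d) := @differentiable_coord R _ _ M i j.
split; first exact: (differentiable_comp df (dc _)).
have -> : 'd (fun x : V => f x i j) (z + t *: (y - z)) (y - z) =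
    ('d f (z + t *: (y - z)) (y - z)) i j.
  have bA := blin_diff df.
  have sc M : sder (fun N : 'rV[R]_d => N i j) M (fun N => N i j).
    apply: sder_lin; split=> [a u v|]; first by rewrite !mxE.
    by exists 1 => // u; rewrite mul1r le_mx_norm.
  rewrite (_ : (fun x => f x i j) = (fun N : 'rV[R]_d => N i j) \o f) //.
  by rewrite (diff_comp df (dc _)) /= (sder_diff (sc (f _))).2.
by apply: le_trans hd; have := le_mx_norm ('d f (z + t *: (y - z)) (y - z) - c) i j; rewrite !mxE.
Qed.

Lemma segment_ball V (x y z : V) (r t : R) : `|y - x| < r -> `|z - x| < r ->
  0 <= t <= 1 -> `|z + t *: (y - z) - x| < r.
Proof.
move=> yr zr /andP[t0 t1].
have -> : z + t *: (y - z) - x = (1 - t) *: (z - x) + t *: (y - x).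
  have -> : y - z = (y - x) - (z - x) by rewrite opprB addrA subrK.
  by rewrite (scalerBr t (y - x)) scalerBl scale1r addrAC -[RHS]addrA [- (t *: (z - x)) + _]addrC.
have t1' : 0 <= 1 - t by rewrite subr_ge0.
rewrite (le_lt_trans (ler_normD _ _)) // !normrZ !ger0_norm //.
have [->|tn0] := eqVneq t 0; first by rewrite subr0 mul1r mul0r addr0.
have -> : r = (1 - t) * r + t * r by ring.
rewrite ler_ltD //; first by rewrite ler_wpM2l // ltW.
by rewrite ltr_pM2l // lt0r tn0.
Qed.

(** The mean value inequality is taken as a premise so that the same proof serves the real-valued
    norm [N] and the vector-valued [f]. *)
Lemma sder_of_C1 V W (f : V -> W) x :
  (forall (y z : V) (c : W) (e : R), 0 <= e ->
    (forall t : R, 0 <= t <= 1 -> differentiable f (z + t *: (y - z)) /\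
      `|'d f (z + t *: (y - z)) (y - z) - c| <= e) -> `|f y - f z - c| <= e) ->
  (\forall y \near x, differentiable f y) ->
  (forall e : R, 0 < e -> \forall y \near x, forall h, `|'d f y h - 'd f x h| <= e * `|h|) ->
  sder f x ('d f x).
Proof.
move=> mv df cf; split; first by apply: blin_diff; exact: nbhs_singleton df.
move=> e e0.
have /near_ballP[r r0 hr] : \forall y \near x, differentiable f y /\
  forall h, `|'d f y h - 'd f x h| <= e * `|h|.
  by apply: filterI => //; exact: cf.
exists r => // y z yr zr.
apply: mv => [|t t01]; first by rewrite mulr_ge0 // ltW.
by have [] := hr _ (segment_ball yr zr t01).
Qed.

(** Near [x] the map [f - D x] is [e]-Lipschitz, hence so it is near each close [y], and its
    derivative [D y - D x] there is bounded by [e]. *)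
Lemma sder_C1 V W (f : V -> W) (U : set V) (D : V -> V -> W) : open U ->
  (forall x, U x -> sder f x (D x)) -> forall x, U x -> forall e : R, 0 < e ->
  \forall y \near x, forall h, `|'d f y h - 'd f x h| <= e * `|h|.
Proof.
move=> oU sf x Ux e e0.
have [r r0 hr] := (sf x Ux).2 e e0.
have nr : \forall y \near x, `|y - x| < r by apply/near_ballP; exists r.
near=> y => h.
have Uy : U y by near: y; exact: open_nbhs_nbhs.
rewrite (sder_diff (sf x Ux)).2 (sder_diff (sf y Uy)).2.
have yr : `|y - x| < r by near: y.
apply: (@sder_bound _ _ _ (fun u => f u - D x u) y (fun h => D y h - D x h)).
- by apply: sderB; [exact: sf|apply: sder_lin; exact: (sf x Ux).1].
- exact: ltW.
exists (r - `|y - x|); first by rewrite subr_gt0.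
move=> u v; rewrite !ltrBrDr => ur vr.
have := hr u v.
have tri w : `|w - x| <= `|w - y| + `|y - x| by rewrite -{1}(subrK y w) -addrA ler_normD.
move=> /(_ (le_lt_trans (tri u) ur) (le_lt_trans (tri v) vr)).
have -> : f u - D x u - (f v - D x v) = f u - f v - D x (u - v).
  by rewrite (blinB _ _ (sf x Ux).1) !opprD !opprK addrACA.
by [].
Unshelve. all: by end_near. Qed.

End differentiability.

Section euclidean.
Set Implicit Arguments. Unset Strict Implicit.
Context {R : realType} {d : nat}.
Implicit Types v : 'rV[R]_d.

Lemma le_enorm v : `|v| <= enorm v.
Proof.
apply: mx_norm_leP => [|i j]; first exact: sqrtr_ge0.
rewrite -sqrtr_sqr ler_sqrt; last by apply: sumr_ge0 => k _; exact: sqr_ge0.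
rewrite (ord1 i) (bigD1 j) //= lerDl; apply: sumr_ge0 => k _; exact: sqr_ge0.
Qed.

(** The crude factor [d] suffices: the construction runs in the maximum norm with the tolerance
    divided by [d%:R + 1]. *)
Lemma enorm_le v : enorm v <= d%:R * `|v|.
Proof.
have h0 : 0 <= d%:R * `|v| by rewrite mulr_ge0.
rewrite -[leRHS]ger0_norm // -sqrtr_sqr ler_sqrt ?sqr_ge0 //.
apply: (@le_trans _ _ (\sum_(i < d) `|v| ^+ 2)).
  apply: ler_sum => i _; rewrite -[leLHS]ger0_norm ?sqr_ge0 // normrX.
  by rewrite lerXn2r ?nnegrE // le_mx_norm.
rewrite sumr_const card_ord -[leLHS]mulr_natl exprMn ler_wpM2r ?sqr_ge0 //.
by rewrite -natrX ler_nat; case: (d) => // n; rewrite leq_pmulr.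
Qed.

End euclidean.

(** * Unconditional bases *)

Section rearrangement.
Set Implicit Arguments. Unset Strict Implicit.
Context {R : realType} {E : normedModType R}.

Lemma cvg_seqP (u : nat -> E) (l : E) : u @ \oo --> l <->
  forall eps : R, 0 < eps -> exists N : nat, forall n, (N <= n)%N -> `|u n - l| < eps.
Proof.
split=> [/cvgrPdist_lt h eps e0|h].
  by have [N _ hN] := h _ e0; exists N => n Nn; rewrite distrC; apply: hN.
apply/cvgrPdist_lt => eps e0; have [N hN] := h _ e0.
by exists N => // n Nn; rewrite distrC; apply: hN.
Qed.

Variable z : nat -> E.
Hypothesis unbounded : forall B : R, exists2 s : seq nat, uniq s & B < `|\sum_(i <- s) z i|.

(** Removing the single index [m] from a finite sum changes its norm by at most that of [z m], so
    large sums remain available after any finite set of indices is forbidden. *)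
Lemma unbounded_tails m (B : R) : exists s : seq nat,
  [/\ uniq s, all (leq m) s & B < `|\sum_(i <- s) z i|].
Proof.
elim: m B => [|m ih] B.
  by have [s us hs] := unbounded B; exists s; split => //; apply/allP.
have [s [us am hs]] := ih (B + `|z m|).
exists [seq i <- s | i != m]; split; first exact: filter_uniq.
  apply/allP => i; rewrite mem_filter => /andP[im /(allP am)].
  by rewrite leq_eqVlt eq_sym (negPf im).
rewrite big_filter.
have [ms|ms] := boolP (m \in s).
  rewrite (bigD1_seq m) //= in hs.
  have := ler_normD (z m) (\sum_(i <- s | i != m) z i).
  by move/(lt_le_trans hs); rewrite addrC ltrD2l.
rewrite (_ : \sum_(i <- s | i != m) z i = \sum_(i <- s) z i); last first.
  rewrite [RHS]big_seq [LHS]big_seq_cond; apply: eq_bigl => i.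
  by have [/= si|//] := boolP (i \in s); apply: contra ms => /eqP <-.
by apply: le_lt_trans hs; rewrite lerDl.
Qed.

Definition far_block m := projT1 (cid (unbounded_tails m 1)).

Lemma far_blockP m : [/\ uniq (far_block m), all (leq m) (far_block m) &
  1 < `|\sum_(i <- far_block m) z i|].
Proof. by rewrite /far_block; case: cid. Qed.

(** One past the largest index of the block. Filling in the missing indices below it turns each
    prefix into a permutation of an initial segment. *)
Definition block_end m := (\max_(i <- far_block m) i).+1.

(* If the subsums are unbounded, a rearrangement that lists the blocks
   [far_block] consecutively has partial sums that are not Cauchy. *)
Definition extend w := w ++ far_block (size w) ++
  [seq i <- iota (size w) (block_end (size w) - size w) | i \notin far_block (size w)].

Definition prefixes k := iter k extend [::].

Lemma block_end_gt m : (m < block_end m)%N.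
Proof.
have [u a] := far_blockP m; rewrite /block_end.
case: (far_block m) a => [|i s] /= a; first by rewrite big_nil normr0 ltr10.
move=> _; rewrite ltnS big_cons leq_max.
by case/andP: a => ->.
Qed.

Lemma perm_extend w : perm_eq w (iota 0 (size w)) ->
  perm_eq (extend w) (iota 0 (block_end (size w))).
Proof.
move=> pw; have [u a _] := far_blockP (size w); have lt := block_end_gt (size w).
rewrite /extend -[X in iota 0 X](subnKC (ltnW lt)) iotaD add0n perm_cat //.
apply: uniq_perm; last 2 first.
- exact: iota_uniq.
- move=> i; rewrite mem_cat mem_filter mem_iota subnKC ?(ltnW lt) //.
  have [ib|//] := boolP (i \in _); rewrite /= (allP a) //=.
  apply/esym; rewrite ltnS.
  exact: (@leq_bigmax_seq _ _ _ id i ib).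
rewrite cat_uniq u filter_uniq ?iota_uniq // andbT /=.
by apply/hasPn => i; rewrite mem_filter => /andP[].
Qed.

Lemma size_extend w : perm_eq w (iota 0 (size w)) -> size (extend w) = block_end (size w).
Proof. by move=> /perm_extend/perm_size; rewrite size_iota. Qed.

Lemma perm_prefixes k : perm_eq (prefixes k) (iota 0 (size (prefixes k))).
Proof.
elim: k => [//|k ih]; rewrite /prefixes iterS -/(prefixes k).
by rewrite size_extend // perm_extend.
Qed.

Lemma size_prefixesS k : (size (prefixes k) < size (prefixes k.+1))%N.
Proof.
rewrite [prefixes k.+1]/prefixes iterS -/(prefixes k).
by rewrite size_extend ?block_end_gt // perm_prefixes.
Qed.

Lemma size_prefixes k : (k <= size (prefixes k))%N.
Proof. by elim: k => // k ih; exact: leq_ltn_trans ih (size_prefixesS k). Qed.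

Lemma nth_prefixes k j i : (i < size (prefixes k))%N -> (k <= j)%N ->
  nth 0%N (prefixes j) i = nth 0%N (prefixes k) i.
Proof.
move=> ik /subnKC <-; elim: (j - k)%N => [|l ih]; first by rewrite addn0.
rewrite addnS [prefixes _.+1]/prefixes iterS -/(prefixes (k + l)) nth_cat.
rewrite ih ifT //; apply: leq_trans ik _.
elim: (l) => [|l' ih']; first by rewrite addn0.
by rewrite addnS (leq_trans ih') // ltnW // size_prefixesS.
Qed.

(** After [i.+1] extensions the prefix has more than [i] entries, so the default of [nth] is never
    returned. *)
Definition rearr i := nth 0%N (prefixes i.+1) i.

Lemma rearrE k i : (i < size (prefixes k))%N -> rearr i = nth 0%N (prefixes k) i.
Proof.
move=> ik; rewrite /rearr; have h := size_prefixes i.+1.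
have [le|lt] := leqP k i.+1; first exact: nth_prefixes.
by rewrite [RHS](@nth_prefixes i.+1) // ltnW.
Qed.

Lemma rearr_bij : bijective rearr.
Proof.
have inj : injective rearr.
  move=> i j; pose k := (maxn i j).+1.
  have ik : (i < size (prefixes k))%N.
    by apply: leq_trans (size_prefixes k); rewrite ltnS leq_maxl.
  have jk : (j < size (prefixes k))%N.
    by apply: leq_trans (size_prefixes k); rewrite ltnS leq_maxr.
  rewrite (rearrE ik) (rearrE jk) => /eqP; rewrite nth_uniq // => [/eqP //|].
  by rewrite (perm_uniq (perm_prefixes k)) iota_uniq.
have sur j : rearr (index j (prefixes j.+1)) = j.
  have jin : j \in prefixes j.+1.
    by rewrite (perm_mem (perm_prefixes _)) mem_iota size_prefixes.
  by rewrite (@rearrE j.+1) ?index_mem // nth_index.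
by exists (fun j => index j (prefixes j.+1)) => // i; apply: inj; rewrite sur.
Qed.

Lemma rearr_divergent (l : E) : ~ (series (fun n => z (rearr n)) @ \oo --> l).
Proof.
move=> /cvg_seqP /(_ (1 / 2)) [//|k hk].
have uE n p : (n <= size (prefixes p))%N ->
    series (fun n => z (rearr n)) n = \sum_(i <- take n (prefixes p)) z i.
  move=> np; rewrite /series /= [RHS](big_nth 0%N) size_take.
  rewrite (_ : (if _ then _ else _) = n); last first.
    by case: ltnP => // h; apply/eqP; rewrite eqn_leq np h.
  rewrite !big_nat; apply: eq_bigr => i /andP[_ iltn].
  by rewrite (@rearrE p) ?(leq_trans iltn) // nth_take.
(* The partial sums at [m] and [n] differ by exactly one far block, of norm above 1, while both
   should be within 1/2 of [l]. *)
pose m := size (prefixes k); pose n := (m + size (far_block m))%N.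
have km : (k <= m)%N by exact: size_prefixes.
have E1 := uE m k (leqnn _); rewrite take_size in E1.
have P2 : prefixes k.+1 = prefixes k ++ far_block m ++
  [seq i <- iota m (block_end m - m) | i \notin far_block m] by [].
have E2 := uE n k.+1; rewrite P2 catA take_size_cat ?size_cat // in E2.
have {}E2 := E2 (leq_addr _ _).
have [_ _] := far_blockP m; apply/negP; rewrite -leNgt.
have -> : \sum_(i <- far_block m) z i =
    (series (fun n => z (rearr n)) n - l) - (series (fun n => z (rearr n)) m - l).
  by rewrite E1 E2 big_cat /= opprB addrA subrK addrC addKr.
rewrite (le_trans (ler_normB _ _)) // (splitr 1) lerD // ltW // hk //.
by rewrite (leq_trans km) // leq_addr.
Qed.

End rearrangement.

Section multipliers.
Set Implicit Arguments. Unset Strict Implicit.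
Context {R : realType} {E : normedModType R}.

Lemma cvg_sum_ord n (f : nat -> nat -> E) (l : nat -> E) :
  (forall i, f i @ \oo --> l i) ->
  (fun k => \sum_(i < n) f i k) @ \oo --> \sum_(i < n) l i.
Proof.
move=> h; elim: n => [|n ih].
  by rewrite big_ord0; under eq_fun do rewrite big_ord0; exact: cvg_cst.
by rewrite big_ord_recr; under eq_fun do rewrite big_ord_recr; exact: cvgD.
Qed.

Lemma cvg_norm_le (u : nat -> E) (l : E) (B : R) :
  u @ \oo --> l -> (forall n, `|u n| <= B) -> `|l| <= B.
Proof.
move=> /cvg_seqP h uB; apply/ler_addgt0Pr => eps e0.
have [N /(_ N (leqnn N)) hN] := h _ e0.
rewrite -[l](subKr (u N)) (le_trans (ler_normB _ _)) // lerD // ltW //.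
Qed.

Lemma bounded_subsums (z : nat -> E) (l : E) :
  (forall s : nat -> nat, bijective s -> series (fun n => z (s n)) @ \oo --> l) ->
  exists B : R, forall s : seq nat, uniq s -> `|\sum_(i <- s) z i| <= B.
Proof.
move=> h; apply: contrapT => nB.
have unb : forall B : R, exists2 s : seq nat, uniq s & B < `|\sum_(i <- s) z i|.
  move=> B; apply: contrapT => nb; apply: nB; exists B => s us.
  by rewrite leNgt; apply/negP => lt; apply: nb; exists s.
exact: rearr_divergent (h _ (rearr_bij unb)).
Qed.

(** The sum is affine in each [a i], so it is a convex combination of the sums with [a i] equal to 0
    or 1. The vector [w] collects the terms already decided. *)
Lemma convex_multiplier (z : nat -> E) (B : R) (a : nat -> R) n (w : E) :
  (forall i, 0 <= a i <= 1) ->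
  (forall s : seq nat, uniq s -> all (gtn n) s -> `|\sum_(i <- s) z i + w| <= B) ->
  `|\sum_(i < n) a i *: z i + w| <= B.
Proof.
move=> a01; elim: n w => [|n ih] w h.
  by rewrite big_ord0; have := h [::] isT isT; rewrite big_nil.
rewrite big_ord_recr /=; set S := \sum_(i < n) _.
have -> : S + a n *: z n + w = a n *: (S + (z n + w)) + (1 - a n) *: (S + w).
  rewrite !scalerDr scalerBl scale1r !scalerBl !scale1r addrACA.
  rewrite [a n *: S + _]addrC subrK -addrA; congr (_ + _).
  by rewrite -addrA; congr (_ + _); rewrite addrC subrK.
have /andP[a0 a1] := a01 n.
have h1 : `|S + (z n + w)| <= B.
  apply: ih => s us sn; have := h (n :: s); rewrite big_cons /= us andbT.
  rewrite addrCA addrA; apply.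
    by apply/negP => /(allP sn) /=; rewrite ltnn.
  by rewrite ltnSn /=; apply: sub_all sn => i /= /ltnW; rewrite ltnS.
have h2 : `|S + w| <= B.
  by apply: ih => s us sn; apply: h => //; apply: sub_all sn => i /= /ltnW; rewrite ltnS.
rewrite (le_trans (ler_normD _ _)) // !normrZ !ger0_norm ?subr_ge0 //.
have -> : B = a n * B + (1 - a n) * B by ring.
by rewrite lerD // ler_wpM2l // subr_ge0.
Qed.

(** Signed multipliers split into positive and negative parts, whence the doubled bound. *)
Lemma bounded_multiplier (z : nat -> E) (B : R) :
  (forall s : seq nat, uniq s -> `|\sum_(i <- s) z i| <= B) ->
  forall n (a : nat -> R), (forall i, `|a i| <= 1) ->
  `|\sum_(i < n) a i *: z i| <= B + B.
Proof.
move=> h n a a1.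
pose p i := Num.max (a i) 0; pose q i := Num.max (- a i) 0.
have -> : \sum_(i < n) a i *: z i = \sum_(i < n) p i *: z i - \sum_(i < n) q i *: z i.
  rewrite -sumrB; apply: eq_bigr => i _; rewrite -scalerBl; congr (_ *: _).
  rewrite /p /q; case: (leP (a i) 0) => ai.
    by rewrite max_l ?oppr_ge0 // opprK add0r.
  by rewrite max_r ?subr0 // oppr_le0 ltW.
have b (c : nat -> R) : (forall i, 0 <= c i <= 1) -> `|\sum_(i < n) c i *: z i| <= B.
  move=> c01; rewrite -[X in `|X|]addr0; apply: (@convex_multiplier z B c n 0) => // s us _.
  by rewrite addr0 h.
rewrite (le_trans (ler_normB _ _)) // lerD // b // => i.
  by have := a1 i; rewrite ler_norml /p le_max ge_max lexx orbT ler01 andbT /= => /andP[].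
have := a1 i; rewrite ler_norml /q le_max ge_max lexx orbT ler01 andbT /= => /andP[].
by rewrite lerNl.
Qed.

End multipliers.

(** * One multiplier constant for the whole space, by Baire category *)

Section unconditional_constant.
Set Implicit Arguments. Unset Strict Implicit.
Context {R : realType} {E : completeNormedModType R}.
Variables (e : nat -> E) (c : E -> nat -> R).
Hypothesis cP : forall x, series (fun n => c x n *: e n) @ \oo --> x.
Hypothesis cU : forall x a, series (fun n => a n *: e n) @ \oo --> x -> a = c x.

Lemma coefP_lin a u v n : c (a *: u + v) n = a * c u n + c v n.
Proof.
suff <- : (fun n => a * c u n + c v n) = c (a *: u + v) by [].
apply: cU.
have -> : series (fun n => (a * c u n + c v n) *: e n) =
    a *: series (fun n => c u n *: e n) + series (fun n => c v n *: e n).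
  apply/funext => k; rewrite /series !fctE /= scaler_sumr -big_split /=.
  by apply: eq_bigr => i _; rewrite scalerDl scalerA.
by apply: cvgD; [apply: cvgZr; exact: cP|exact: cP].
Qed.

Lemma coefP_basis i n : c (e i) n = (i == n)%:R.
Proof.
suff <- : (fun n => (i == n)%:R) = c (e i) by [].
apply: cU; apply/cvg_seqP => eps e0; exists i.+1 => k ik.
rewrite /series /= big_mkord (bigD1 (Ordinal ik)) //= eqxx scale1r.
rewrite big1 ?addr0 ?subrr ?normr0 // => j ji.
by rewrite (_ : (i == j) = false) ?scale0r //; apply/negbTE; apply: contra ji => /eqP ij; apply/eqP/val_inj.
Qed.

Lemma coefP0 n : c 0 n = 0.
Proof. by have := coefP_lin (-1) 0 0 n; rewrite scaler0 addr0 mulN1r addNr. Qed.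

Lemma basis_neq0 i : e i != 0.
Proof.
apply/eqP => e0.
have := coefP_basis i i; rewrite eqxx e0 => c1.
by move: c1; rewrite coefP0 => /eqP; rewrite eq_sym oner_eq0.
Qed.

(** The least such [M] is the classical renorming that makes the basis 1-unconditional; it has to be
    compared with the given norm. *)
Definition mult_bounded (M : R) (x : E) := forall n (a : nat -> R),
  (forall i, `|a i| <= 1) -> `|\sum_(i < n) a i *: (c x i *: e i)| <= M.

Lemma mult_bounded0 : mult_bounded 0 0.
Proof.
move=> n a _; rewrite big1 ?normr0 // => i _.
by rewrite coefP0 scale0r scaler0.
Qed.

Lemma mult_bounded_lin t M M' u v : mult_bounded M u -> mult_bounded M' v ->
  mult_bounded (`|t| * M + M') (t *: u + v).
Proof.
move=> hu hv n a a1.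
have -> : \sum_(i < n) a i *: (c (t *: u + v) i *: e i) =
    t *: (\sum_(i < n) a i *: (c u i *: e i)) + \sum_(i < n) a i *: (c v i *: e i).
  rewrite scaler_sumr -big_split /=; apply: eq_bigr => i _.
  by rewrite coefP_lin scalerDl scalerDr !scalerA; congr (_ *: _ + _); ring.
rewrite (le_trans (ler_normD _ _)) // normrZ lerD ?hv //.
by rewrite ler_wpM2l // hu.
Qed.

Lemma mult_bounded_le M M' u : M <= M' -> mult_bounded M u -> mult_bounded M' u.
Proof. by move=> MM h n a a1; apply: le_trans MM; exact: h. Qed.

Lemma mult_bounded_coef M u i : mult_bounded M u -> `|c u i| * `|e i| <= M.
Proof.
move=> h; have := h i.+1 (fun j => (j == i)%:R).
rewrite (bigD1 ord_max) //= eqxx scale1r big1 ?addr0 ?normrZ => [|j ji].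
  by apply=> j; case: eqP => _; rewrite ?normr1 ?normr0.
rewrite (_ : (val j == i) = false) ?scale0r //.
by apply/negbTE; apply: contra ji => /eqP ij; apply/eqP/val_inj.
Qed.

Hypothesis ub : forall x, exists M, mult_bounded M x.

(** The coefficients are not yet known to be continuous, nor the sets [F n] to be closed, so Baire
    only yields a ball in the closure of one of them: hence approximation instead of membership.
    Subtracting approximants of the centre moves the ball to the origin, and scaling gives the
    linear bound. *)
Lemma dense_mult_bounded : exists2 C : R, 0 < C & forall (h : E) (eps : R), 0 < eps ->
  exists2 y, mult_bounded (C * `|h|) y & `|h - y| < eps.
Proof.
pose F (n : nat) := [set x | mult_bounded n%:R x].
have [n nd] : exists n, ~ dense (~` closure (F n)).
  apply: contrapT => /forallNP h.
  have := @Baire R E (fun n => ~` closure (F n)).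
  have od i : open (~` closure (F i)) /\ dense (~` closure (F i)).
    by split; [apply: closed_openC; exact: closed_closure|apply: contrapT; exact: h].
  move=> /(_ od) /(_ setT) [||x [_ hx]]; [by exists 0|exact: openT|].
  have [M hM] := ub x.
  have [n Mn] : exists n : nat, M <= n%:R.
    by exists (Num.trunc M).+1; rewrite ltW // truncnS_gt.
  by apply: (hx n I); apply: subset_closure; exact: mult_bounded_le Mn hM.
have [D [D0 oD DF]] : exists D : set E, [/\ D !=set0, open D & D `<=` closure (F n)].
  apply: contrapT => /forallNP h; apply: nd => D D0 oD.
  apply: contrapT => /nonemptyPn DF; apply: (h D); split => // x Dx.
  by apply: contrapT => nx; have : (D `&` ~` closure (F n)) x by []; rewrite DF.
have [x0 Dx0] := D0.
have /near_ballP[r r0 hr] : \forall y \near x0, D y by exact: open_nbhs_nbhs.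
have clo y : D y -> forall eps : R, 0 < eps -> exists2 u, mult_bounded n%:R u & `|y - u| < eps.
  move=> /DF cy eps e0; have [|u [Fu yu]] := cy (ball y eps); first exact: nbhsx_ballx.
  by exists u => //; move: yu; rewrite -ball_normE.
have app h (eps : R) : `|h| < r -> 0 < eps ->
    exists2 y, mult_bounded (n%:R + n%:R) y & `|h - y| < eps.
  move=> hlt e0; have e2 : 0 < eps / 2 by rewrite divr_gt0.
  have [u Qu hu] : exists2 u, mult_bounded n%:R u & `|h + x0 - u| < eps / 2.
    by apply: clo => //; apply: hr; rewrite addrK.
  have [v Qv hv] := clo x0 Dx0 _ e2.
  exists (u - v).
    rewrite (addrC u) -scaleN1r. apply: mult_bounded_le _ (mult_bounded_lin _ Qv Qu).
    by rewrite normrN1 mul1r.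
  rewrite (_ : h - (u - v) = (h + x0 - u) - (x0 - v)).
    by rewrite (splitr eps) (le_lt_trans (ler_normB _ _)) // ltrD.
  by rewrite !opprB -(addrA h) -(addrA h) [x0 - u + _]addrC (addrA (v - x0)) subrK.
(* Rescaling from length [r / 2] multiplies the bound [2 * n] by [2 / r] times the norm of [h]; the
   added 1 keeps the constant positive. *)
exists (4 * (n%:R + 1) / r); first by rewrite divr_gt0 // mulr_gt0 // ltr_wpDl.
move=> h eps e0.
have [->|h0] := eqVneq h 0.
  by exists 0; rewrite ?subrr ?normr0 // mulr0; exact: mult_bounded0.
have hn0 : 0 < `|h| by rewrite normr_gt0.
pose t := r / 2 / `|h|.
have t0 : 0 < t by rewrite !divr_gt0.
have [|y Qy hy] := app (t *: h) (t * eps) _ (mulr_gt0 t0 e0).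
  by rewrite normrZ gtr0_norm // divfK ?gt_eqF // ltr_pdivrMr // ltr_pMr // ltr1n.
exists (t^-1 *: y).
  rewrite -[t^-1 *: y]addr0; apply: mult_bounded_le _ (mult_bounded_lin _ Qy mult_bounded0).
  rewrite addr0 gtr0_norm ?invr_gt0 // /t.
  have -> : (r / 2 / `|h|)^-1 * (n%:R + n%:R) = 4 * n%:R / r * `|h|.
    by field; rewrite !gt_eqF.
  by rewrite ler_wpM2r // ler_pM2r ?invr_gt0 // ler_pM2l // lerDl.
have -> : h - t^-1 *: y = t^-1 *: (t *: h - y).
  by rewrite scalerBr scalerA mulVf ?scale1r // gt_eqF.
by rewrite normrZ gtr0_norm ?invr_gt0 // ltr_pdivrMl.
Qed.

(* As in the open mapping theorem: [x] is the sum of a series of multiplier-bounded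
   vectors with geometrically decreasing bounds, whose coefficients also add up. *)
Lemma mult_bounded_unif : exists2 K : R, 0 < K & forall x, mult_bounded (K * `|x|) x.
Proof.
have [C C0 hC] := dense_mult_bounded.
exists (2 * C); first by rewrite mulr_gt0.
move=> x; have [->|x0] := eqVneq x 0.
  by rewrite normr0 mulr0; exact: mult_bounded0.
pose rho := `|x|.
have rho0 : 0 < rho by rewrite normr_gt0.
pose g (j : nat) : R := rho * 2^-1 ^+ j.
have g0 j : 0 < g j by rewrite mulr_gt0 // exprn_gt0 // invr_gt0.
pose apx h j := projT1 (cid2 (hC h (g j.+1) (g0 _))).
have apxP h j : mult_bounded (C * `|h|) (apx h j) /\ `|h - apx h j| < g j.+1.
  by rewrite /apx; case: cid2.
(* [H j] is what remains of [x] after [j] corrections; each correction leaves at most half of the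
   previous bound. *)
pose H := fix H j : E := if j is j'.+1 then H j' - apx (H j') j' else x.
pose y j := apx (H j) j.
have Hle j : `|H j| <= g j.
  by case: j => [|j]; [rewrite /g expr0 mulr1|exact: ltW (apxP _ _).2].
have yb j : mult_bounded (C * g j) (y j).
  by apply: mult_bounded_le _ (apxP _ _).1; rewrite ler_pM2l.
pose Y J := \sum_(j < J) y j.
have xY J : x - Y J = H J.
  elim: J => [|J ih]; first by rewrite /Y big_ord0 subr0.
  by rewrite /Y big_ord_recr /= opprD addrA -/(Y J) ih.
(* The geometric sum of the bounds [C * g j] for [j] from [J] to [J + l - 1], in closed form so that
   the induction telescopes. *)
have YD J l : mult_bounded (2 * C * g J - 2 * C * g (J + l)%N) (Y (J + l)%N - Y J).
  elim: l => [|l ih].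
    by rewrite addn0 !subrr; exact: mult_bounded0.
  have -> : Y (J + l.+1)%N - Y J = 1 *: y (J + l)%N + (Y (J + l)%N - Y J).
    by rewrite addnS /Y big_ord_recr /= scale1r addrCA addrA.
  apply: mult_bounded_le _ (mult_bounded_lin _ (yb _) ih).
  by rewrite normr1 mul1r addnS /g exprS; lra.
have YDle J l : mult_bounded (2 * C * g J) (Y (J + l)%N - Y J).
  by apply: mult_bounded_le _ (YD J l); rewrite gerBl mulr_ge0 // ?ltW ?mulr_gt0.
have gto0 (eps : R) : 0 < eps -> exists J, g J < eps.
  move=> e0; have : geometric rho (2^-1 : R) @ \oo --> (0 : R).
    by apply: cvg_geometric; rewrite gtr0_norm ?invr_gt0 // invf_lt1 // ltr1n.
  move=> /cvgrPdist_lt /(_ _ e0)[N _ hN]; exists N.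
  by have := hN N (leqnn _); rewrite /= sub0r normrN /geometric /= (gtr0_norm (g0 N)).
have cvY i : exists l : R, (fun J => c (Y J) i) @ \oo --> l.
  have -> : (fun J => c (Y J) i) = series (fun j => c (y j) i).
    apply/funext => J; rewrite /Y /series /= big_mkord.
    elim: J => [|J ih]; first by rewrite !big_ord0 coefP0.
    by rewrite !big_ord_recr /= -ih addrC -{1}(scale1r (y J)) coefP_lin mul1r addrC.
  apply/cvg_ex/normed_cvg.
  apply: (@series_le_cvg _ _ (geometric (C * rho / `|e i|) 2^-1)) => [n|n|n|].
  - exact: normr_ge0.
  - by rewrite /geometric /= mulr_ge0 // ?exprn_ge0 // divr_ge0 // mulr_ge0 // ltW.
  - rewrite /geometric /= mulrAC ler_pdivlMr ?normr_gt0 ?basis_neq0 //.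
    by rewrite -mulrA; exact: mult_bounded_coef (yb n).
  - by apply: is_cvg_geometric_series; rewrite gtr0_norm ?invr_gt0 // invf_lt1 // ltr1n.
pose a i := projT1 (cid (cvY i)).
have aP i : (fun J => c (Y J) i) @ \oo --> a i by rewrite /a; case: cid.
(* For fixed [n] this finite sum is a limit of multiplier sums of [Y (l + J) - Y J], so their bound
   survives and does not depend on [n]. *)
have lim_bound J n (b : nat -> R) : (forall i, `|b i| <= 1) ->
    `|\sum_(i < n) b i *: ((a i - c (Y J) i) *: e i)| <= 2 * C * g J.
  move=> b1.
  have cv : (fun l => \sum_(i < n) b i *: (c (Y (l + J)%N - Y J) i *: e i)) @ \oo -->
      \sum_(i < n) b i *: ((a i - c (Y J) i) *: e i).
    apply: (@cvg_sum_ord _ _ _ (fun i l => b i *: (c (Y (l + J)%N - Y J) i *: e i))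
      (fun i => b i *: ((a i - c (Y J) i) *: e i))) => i.
    apply: cvgZr; apply: cvgZl.
    have -> : (fun l => c (Y (l + J)%N - Y J) i) = (fun l => c (Y (l + J)%N) i - c (Y J) i).
      by apply/funext => l; rewrite addrC -scaleN1r coefP_lin mulN1r addrC.
    by apply: cvgB; [rewrite (cvg_shiftn J (fun J => c (Y J) i)); exact: aP|exact: cvg_cst].
  apply: cvg_norm_le cv _ => l; rewrite addnC; exact: YDle.
(* The limits [a] of the coefficients also expand [x], so uniqueness of the expansion replaces
   continuity of the coefficients. *)
have aE : a = c x.
  apply: cU; apply/cvg_seqP => eps e0.
  have e1 : 0 < eps / (2 * (1 + 2 * C)).
    by rewrite divr_gt0 // mulr_gt0 // addr_gt0 // mulr_gt0.
  have [J hJ] := gto0 _ e1.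
  have e2 : 0 < eps / 2 by rewrite divr_gt0.
  have /cvg_seqP /(_ _ e2) [N hN] := @cP (Y J).
  exists N => n Nn.
  have -> : series (fun n => a n *: e n) n - x =
    (series (fun n => c (Y J) n *: e n) n - Y J) +
    (\sum_(i < n) 1 *: ((a i - c (Y J) i) *: e i) - H J).
    have -> : series (fun n => a n *: e n) n = series (fun n => c (Y J) n *: e n) n +
        \sum_(i < n) 1 *: ((a i - c (Y J) i) *: e i).
      rewrite /series /= !big_mkord -big_split /=; apply: eq_bigr => i _.
      by rewrite scale1r -scalerDl addrC subrK.
    by rewrite -xY opprB [RHS]addrACA addKr.
  have lb : `|\sum_(i < n) 1 *: ((a i - c (Y J) i) *: e i)| <= 2 * C * g J.
    by apply: (lim_bound J n (fun=> 1)) => i; rewrite normr1.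
  have hn := hN n Nn.
  apply: le_lt_trans (ler_normD _ _) _.
  rewrite (splitr eps) ltrD // (le_lt_trans (ler_normB _ _)) //.
  apply: le_lt_trans (lerD lb (Hle J)) _.
  have -> : 2 * C * g J + g J = g J * (1 + 2 * C) by ring.
  rewrite -ltr_pdivlMr ?addr_gt0 ?mulr_gt0 //; apply: lt_le_trans hJ _.
  by rewrite invfM mulrA.
(* At [J = 0] nothing has been subtracted and the bound reads [2 * C] times the norm of [x]. *)
move=> n b b1; have := @lim_bound 0%N n b b1.
rewrite /Y big_ord0 /g expr0 mulr1 aE.
by under eq_bigr do rewrite coefP0 subr0.
Qed.

End unconditional_constant.

Section unconditional_basis_theory.
Set Implicit Arguments. Unset Strict Implicit.
Context {R : realType} {E : completeNormedModType R}.

Lemma unconditional_basisP (e : nat -> E) : unconditional_basis e ->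
  exists (c : nat -> E -> R) (K : R), [/\ 0 < K,
    forall i, blin (c i),
    forall i j, c j (e i) = (i == j)%:R,
    forall x, series (fun n => c n x *: e n) @ \oo --> x &
    forall x n (a : nat -> R), (forall i, `|a i| <= 1) ->
      `|\sum_(i < n) a i *: (c i x *: e i)| <= K * `|x|].
Proof.
move=> [sb uc].
have cex (x : E) : exists a : nat -> R, series (fun n => a n *: e n) @ \oo --> x /\
    forall b, series (fun n => b n *: e n) @ \oo --> x -> b = a.
  by have [a [h1 h2]] := sb x; exists a; split=> // b /h2.
pose c x := projT1 (cid (cex x)).
have cP (x : E) : series (fun n => c x n *: e n) @ \oo --> x.
  by rewrite /c; case: cid => ? [].
have cU (x : E) a : series (fun n => a n *: e n) @ \oo --> x -> a = c x.
  by rewrite /c; case: cid => ? [? h]; exact: h.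
have ub x : exists M, mult_bounded e c M x.
  have [B hB] := @bounded_subsums _ _ (fun n => c x n *: e n) x (uc x (c x) (cP x)).
  by exists (B + B) => n a a1; exact: (bounded_multiplier hB n a1).
have [K K0 hK] := mult_bounded_unif cP cU ub.
exists (fun i x => c x i), K; split => //.
- move=> i; split=> [a u v|]; first exact: coefP_lin.
  (* Continuity of the coordinates is a by-product: apply the uniform bound to the multiplier that
     selects one coordinate. *)
  exists (K / `|e i|); first by rewrite divr_ge0 // ltW.
  move=> h; rewrite mulrAC ler_pdivlMr ?normr_gt0 ?(basis_neq0 cP cU) //.
  exact: mult_bounded_coef (hK h).
- by move=> i j; exact: coefP_basis.
Qed.

End unconditional_basis_theory.

(** * Countable families and locally finite sums *)

Section dense_balls.
Set Implicit Arguments. Unset Strict Implicit.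
Context {R : realType} {E : normedModType R}.

Definition rat_comb (e : nat -> E) (s : seq rat) : E :=
  \sum_(i < size s) ratr s`_i *: e i.

Lemma rat_comb_dense (e : nat -> E) (x : E) (a : nat -> R) (eps : R) :
  series (fun n => a n *: e n) @ \oo --> x -> 0 < eps ->
  exists s, `|x - rat_comb e s| < eps.
Proof.
move=> /cvg_seqP h e0; have e2 : 0 < eps / 2 by rewrite divr_gt0.
have [n /(_ n (leqnn n)) hn] := h _ e2.
(* The [n] errors, weighted by the norms of [e i], add up to at most [n / (n + 1)] of [eps / 2],
   hence strictly less. *)
pose dl i := eps / 2 / n.+1%:R / (`|e i| + 1).
have dl0 i : 0 < dl i by rewrite /dl !divr_gt0 // ltr_wpDl.
have rP i : exists r : rat, `|a i - ratr r| < dl i.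
  have /rat_in_itvoo[r] : a i - dl i < a i + dl i by rewrite ltrD2l gtrN.
  rewrite in_itv /= => /andP[r1 r2]; exists r.
  by rewrite ltr_norml; apply/andP; split; lra.
pose r i := projT1 (cid (rP i)).
have rE i : `|a i - ratr (r i)| < dl i by rewrite /r; case: cid.
exists (mkseq r n).
rewrite -(subrK (series (fun n => a n *: e n) n) x) -addrA.
rewrite (splitr eps) (le_lt_trans (ler_normD _ _)) // ltrD //.
  by rewrite distrC.
rewrite /rat_comb /series /= size_mkseq big_mkord -sumrB.
apply: (@le_lt_trans _ _ (\sum_(i < n) eps / 2 / n.+1%:R)).
  apply: le_trans (ler_norm_sum _ _ _) _; apply: ler_sum => i _.
  rewrite nth_mkseq // -scalerBl normrZ.
  apply: (@le_trans _ _ (dl i * (`|e i| + 1))).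
    by rewrite ler_pM // ?lerDl // ltW.
  by rewrite /dl divfK // gt_eqF // ltr_wpDl.
rewrite sumr_const card_ord -[ltLHS]mulr_natr -mulrA gtr_pMr //.
by rewrite mulrC ltr_pdivrMr // mul1r ltr_nat.
Qed.

(** The radius is chosen first and the centre approximated afterwards, so the centre can lie within
    any fraction [s] of the radius. The partition of unity needs this, since its functions equal 1
    only on a fixed fraction of each ball. *)
Lemma dense_balls (e : nat -> E) (c : nat -> E -> R) :
  (forall x, series (fun n => c n x *: e n) @ \oo --> x) ->
  exists (q : nat -> E) (rho : nat -> R), (forall k, 0 < rho k) /\
    forall (x : E) (r s : R), 0 < r -> 0 < s -> exists k,
      `|x - q k| < s * rho k /\ rho k < r.
Proof.
move=> cP.
pose dec k : seq rat * nat := odflt ([::], 0%N) (unpickle k).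
exists (fun k => rat_comb e (dec k).1), (fun k => (dec k).2.+1%:R^-1).
split=> [k|x r s r0 s0]; first by rewrite invr_gt0.
pose m := Num.trunc r^-1.
have mr : m.+1%:R^-1 < r.
  rewrite -[r]invrK ltf_pV2 ?posrE ?invr_gt0 //.
  by rewrite truncnS_gt.
have sm : 0 < s * m.+1%:R^-1 by rewrite mulr_gt0 // invr_gt0.
have [t ht] := rat_comb_dense (cP x) sm.
by exists (pickle (t, m)); rewrite /dec pickleK.
Qed.

End dense_balls.

Section locally_finite_sum.
Set Implicit Arguments. Unset Strict Implicit.
Context {R : realType} {V W : normedModType R}.
Variable h : nat -> V -> W.

(** The value 0 is a filler at points where the terms do not eventually vanish. *)
Definition lfsum (x : V) : W :=
  if pselect (exists n, forall k, (n <= k)%N -> h k x = 0) is left p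
  then \sum_(k < projT1 (cid p)) h k x else 0.

Lemma sum_vanish m n x : (forall k, (n <= k)%N -> h k x = 0) -> (n <= m)%N ->
  \sum_(k < m) h k x = \sum_(k < n) h k x.
Proof.
move=> hn nm; rewrite -!(big_mkord xpredT (fun k => h k x)).
rewrite (big_cat_nat _ nm) //= -[RHS]addr0; congr (_ + _).
by rewrite big_nat_cond big1 // => k /andP[/andP[nk _] _]; exact: hn.
Qed.

Lemma lfsumE n x : (forall k, (n <= k)%N -> h k x = 0) ->
  lfsum x = \sum_(k < n) h k x.
Proof.
move=> hn; rewrite /lfsum; case: pselect => [p|[]]; last by exists n.
case: cid => m hm /=.
by have [le|/ltnW le] := leqP n m; [|apply/esym]; exact: sum_vanish.
Qed.

End locally_finite_sum.

Section finite_codimension_filter.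
Set Implicit Arguments. Unset Strict Implicit.
Context {R : realType} {E : normedModType R}.
Variable F : nat -> E -> R.

(** Neighbourhoods of 0 inside the kernels of finitely many [F i]. With [v] as the increment,
    [g (x + v) = g x] holding in this filter is the form of local dependence on finitely many
    functionals used below; the filter structure merges several such conditions. *)
Definition wnear : set_system E := fun P => exists n, exists2 r : R, 0 < r &
  forall v, `|v| < r -> (forall i, (i < n)%N -> F i v = 0) -> P v.

#[global] Instance wnear_filter : Filter wnear.
Proof.
split.
- by exists 0%N, 1.
- move=> P Q [n [r r0 hP]] [m [s s0 hQ]].
  exists (maxn n m), (Num.min r s); first by rewrite lt_min r0.
  move=> v; rewrite lt_min => /andP[vr vs] hv; split.
    by apply: hP => // i im; apply: hv; rewrite leq_max im.
  by apply: hQ => // i im; apply: hv; rewrite leq_max im orbT.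
- by move=> P Q PQ [n [r r0 h]]; exists n, r => // v *; apply/PQ/h.
Qed.

Lemma wnear_nbhs (P : set E) : (\forall v \near (0 : E), P v) -> wnear P.
Proof. by move=> /near_ballP[r r0 h]; exists 0%N, r => // v vr _; apply: h; rewrite subr0. Qed.

Lemma wnear_shift (x : E) (P : set E) : (\forall y \near x, P y) ->
  wnear (fun v => P (x + v)).
Proof.
move=> /near_ballP[r r0 h]; exists 0%N, r => // v vr _; apply: h.
by rewrite (addrC x) addrK.
Qed.

Lemma wnear_killed i : wnear (fun v => F i v = 0).
Proof. by exists i.+1, 1 => // v _; apply. Qed.

Lemma wnear_forall n (P : nat -> set E) : (forall k, (k < n)%N -> wnear (P k)) ->
  wnear (fun v => forall k, (k < n)%N -> P k v).
Proof.
elim: n => [|n ih] h; first exact: filterE.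
have h1 : wnear (fun v => forall k, (k < n)%N -> P k v).
  by apply: ih => k kn; apply: h; rewrite ltnS ltnW.
apply: filterS2 h1 (h n (ltnSn n)) => v h1 h2 k.
by rewrite ltnS leq_eqVlt => /orP[/eqP->|/h1].
Qed.

Lemma wnear_scale (s : R) (P : set E) : (forall i, blin (F i)) ->
  wnear P -> wnear (fun v => P (s *: v)).
Proof.
move=> bF [n [r r0 h]]; exists n, (r / (`|s| + 1)).
  by rewrite divr_gt0 // ltr_wpDl.
move=> v; rewrite ltr_pdivlMr ?ltr_wpDl // => vr hv; apply: h.
  by rewrite normrZ mulrC (le_lt_trans _ vr) // ler_wpM2l // lerDl.
by move=> i /hv vi; rewrite (blinZ _ _ (bF i)) vi scaler0.
Qed.

End finite_codimension_filter.

(** * A cut-off of the norm *)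

Section smooth_step.
Set Implicit Arguments. Unset Strict Implicit.
Context {R : realType}.
Implicit Types s t : R.

Definition pos t := Num.max t 0.

Lemma posP t : (pos t = 0 /\ t <= 0) \/ (pos t = t /\ 0 <= t).
Proof. by rewrite /pos; case: leP => h; [left|right]; split => //; exact: ltW. Qed.

Lemma sder_pos2 t : sder (fun s => pos s ^+ 2) t (fun h => (2 * pos t) *: (h : R)).
Proof.
split.
  by apply: blin_scale; exact: blin_id.
move=> e e0; exists (e / 4); first by rewrite divr_gt0.
move=> y z yt zt.
have h1 : `|pos y ^+ 2 - pos z ^+ 2 - 2 * pos z * (y - z)| <= `|y - z| * `|y - z|.
  have -> : `|y - z| * `|y - z| = (y - z) ^+ 2.
    by rewrite -normrM ger0_norm // -expr2 sqr_ge0.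
  rewrite ler_norml.
  have [[-> y0]|[-> y0]] := posP y; have [[-> z0]|[-> z0]] := posP z.
  - by rewrite mulr0 !mul0r subr0 subrr oppr_le0 sqr_ge0.
  - have h : 0 <= - y * z by rewrite mulr_ge0 // oppr_ge0.
    have := sqr_ge0 y; have := sqr_ge0 z; rewrite !expr2 => hz hy.
    by apply/andP; split; lra.
  - have h : 0 <= y * - z by rewrite mulr_ge0 // oppr_ge0.
    have := sqr_ge0 y; have := sqr_ge0 z; rewrite !expr2 => hz hy.
    by apply/andP; split; lra.
  - have := sqr_ge0 (y - z); rewrite !expr2 => hz.
    by apply/andP; split; lra.
have h2 : `|pos z - pos t| <= `|z - t|.
  by have [[-> y0]|[-> y0]] := posP t; have [[-> z0]|[-> z0]] := posP z;
    rewrite ?subrr ?normr0 // ler_norml; apply/andP; split;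
    case: (ler0P (z - t)) => ?; lra.
have -> : pos y ^+ 2 - pos z ^+ 2 - (2 * pos t) *: (y - z) =
   (pos y ^+ 2 - pos z ^+ 2 - 2 * pos z * (y - z)) + 2 * (pos z - pos t) * (y - z).
  by rewrite -[(2 * pos t) *: (y - z)]/(2 * pos t * (y - z)); ring.
have h3 : `|y - z| <= `|y - t| + `|z - t|.
  by rewrite -(subrK t y) -addrA (le_trans (ler_normD _ _)) // addrK lerD // distrC.
apply: le_trans (ler_normD _ _) _.
apply: le_trans (lerD h1 (lexx _)) _.
rewrite normrM normrM [`|2|]ger0_norm // -mulrDl ler_wpM2r //.
by move: h2 h3 yt zt; lra.
Qed.

(** The square of a positive part is C^1; nesting two of them gives a C^1 step exactly 0 up to 1 and
    exactly 1 from 2 on. *)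
Definition smoothstep t := 1 - pos (1 - pos (t - 1) ^+ 2) ^+ 2.

Lemma sder_smoothstep t : exists A, sder smoothstep t A.
Proof.
have h1 : sder (fun s => s - 1) t (fun h => h - 0).
  by apply: sderB; [apply: sder_lin; exact: blin_id|exact: sder_cst].
have h2 := sderB (sder_cst (1 : R) t) (sder_comp h1 (sder_pos2 _)).
by eexists; exact: (sderB (sder_cst (1 : R) t) (sder_comp h2 (sder_pos2 _))).
Qed.

Lemma smoothstep0 t : t <= 1 -> smoothstep t = 0.
Proof.
move=> t1; rewrite /smoothstep; have [[-> _]|[-> h]] := posP (t - 1).
  by rewrite expr0n /= subr0 /pos max_l // expr1n subrr.
have -> : t - 1 = 0 by lra.
by rewrite expr0n /= subr0 /pos max_l // expr1n subrr.
Qed.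

Lemma smoothstep1 t : 2 <= t -> smoothstep t = 1.
Proof.
move=> t1; rewrite /smoothstep; have [[_ h]|[-> h]] := posP (t - 1); first by lra.
by rewrite /pos max_r ?expr2 ?mul0r ?subr0 //; nra.
Qed.

Lemma smoothstep_ge0 t : 0 <= smoothstep t.
Proof.
rewrite /smoothstep; set u := pos (t - 1).
have := sqr_ge0 u; have [[-> _]|[-> h]] := posP (1 - u ^+ 2); nra.
Qed.

Lemma smoothstep_le1 t : smoothstep t <= 1.
Proof. by rewrite gerBl sqr_ge0. Qed.

Lemma pos2_lip s t (M : R) : pos s <= M -> pos t <= M ->
  `|pos s ^+ 2 - pos t ^+ 2| <= (M + M) * `|s - t|.
Proof.
move=> hs ht.
have h : `|pos s - pos t| <= `|s - t|.
  by have [[-> y0]|[-> y0]] := posP s; have [[-> z0]|[-> z0]] := posP t;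
    rewrite ?subrr ?normr0 // ler_norml; apply/andP; split;
    case: (ler0P (s - t)) => ?; lra.
rewrite subr_sqr normrM mulrC ler_pM // ger0_norm ?lerD //.
by apply: addr_ge0; rewrite /pos le_max lexx orbT.
Qed.

Lemma smoothstep_lip s t : `|smoothstep s - smoothstep t| <= 4 * `|s - t|.
Proof.
(* The inner square is not globally Lipschitz, so arguments are first clipped at 2, beyond which the
   step is constant. Each of the two squares then contributes a factor 2. *)
have trunc r : smoothstep r = smoothstep (Num.min r 2).
  by case: (leP r 2) => // /ltW h; rewrite !smoothstep1.
rewrite trunc (trunc t).
have h : `|Num.min s 2 - Num.min t 2| <= `|s - t|.
  by case: (leP s 2) => ?; case: (leP t 2) => ?; rewrite ler_norml; apply/andP; split;
    case: (ler0P (s - t)) => ?; lra.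
have s2 : Num.min s 2 <= 2 by rewrite ge_min lexx orbT.
have t2 : Num.min t 2 <= 2 by rewrite ge_min lexx orbT.
move: (Num.min s 2) (Num.min t 2) s2 t2 h => s' t' s2 t2 h.
apply: (@le_trans _ _ (4 * `|s' - t'|)); last by rewrite ler_pM2l.
have -> : smoothstep s' - smoothstep t' =
  pos (1 - pos (t' - 1) ^+ 2) ^+ 2 - pos (1 - pos (s' - 1) ^+ 2) ^+ 2.
  by rewrite /smoothstep; ring.
have b r : pos (1 - pos (r - 1) ^+ 2) <= 1.
  by rewrite /pos ge_max ler01 andbT gerBl sqr_ge0.
apply: (le_trans (pos2_lip (b _) (b _))).
have -> : 1 - pos (t' - 1) ^+ 2 - (1 - pos (s' - 1) ^+ 2) =
  pos (s' - 1) ^+ 2 - pos (t' - 1) ^+ 2 by ring.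
have b' r : r <= 2 -> pos (r - 1) <= 1 by move=> r2; rewrite /pos ge_max ler01 andbT; lra.
apply: (@le_trans _ _ (2 * ((1 + 1) * `|s' - 1 - (t' - 1)|))).
  by rewrite -[X in X * _]/(2%:R) ler_wpM2l // pos2_lip // b'.
have -> : s' - 1 - (t' - 1) = s' - t' by ring.
lra.
Qed.

End smooth_step.

Section bump.
Set Implicit Arguments. Unset Strict Implicit.
Context {R : realType} {E : normedModType R}.
Variables (N : E -> R) (q : nat -> E) (rho : nat -> R).
Hypothesis rho0 : forall k, 0 < rho k.
Hypothesis dens : forall (x : E) (r s : R), 0 < r -> 0 < s -> exists k,
      `|x - q k| < s * rho k /\ rho k < r.
Hypothesis eN : equivalent_norm N.
Hypothesis cN : C1_away_origin N.
Hypothesis lN : locally_finitely_many_coords N.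

(** It vanishes where [N] is below 1, which hides the origin, where neither smoothness nor finite
    dependence of [N] is assumed. *)
Definition bump (z : E) := smoothstep (N z).

Lemma norm_lip : exists2 C : R, 0 < C & (forall x, N x <= C * `|x|) /\
  forall x y, `|N x - N y| <= C * `|x - y|.
Proof.
have [tri hom _ [c [C [c0 C0 cC]]]] := eN.
have NN u : N (- u) = N u by rewrite -scaleN1r hom normrN1 mul1r.
exists C => //; split=> [x|x y]; first by have [] := cC x.
apply: le_trans (cC (x - y)).2.
have main u w : N u - N w <= N (u - w).
  by rewrite lerBlDr -{1}(subrK w u) tri.
rewrite ler_norml main andbT lerNl opprB.
by rewrite -[N (x - y)]NN opprB main.
Qed.

Lemma sder_norm z : z != 0 -> sder N z ('d N z).
Proof.
move=> z0; apply: sder_of_C1.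
- by move=> y w c e _; exact: mean_value_real.
- have /near_ballP[r r0 hr] : \forall y \near z, y != 0.
    apply/near_ballP; exists `|z|; first by rewrite normr_gt0.
    by move=> y; apply: contraTneq => ->; rewrite sub0r normrN ltxx.
  by apply/near_ballP; exists r => // y /hr /cN[].
- by have [] := cN z0.
Qed.

Lemma near_norm_lt z (t : R) : N z < t -> \forall y \near z, N y < t.
Proof.
move=> zt; have [C C0 [_ lip]] := norm_lip.
apply/near_ballP; exists ((t - N z) / C); first by rewrite divr_gt0 // subr_gt0.
move=> y; rewrite ltr_pdivlMr // mulrC => yz.
have := le_lt_trans (lip y z) yz.
by rewrite ltr_norml ltrD2r => /andP[].
Qed.

Lemma bump_sder z : exists A, sder bump z A.
Proof.
have [z1|z1] := ltP (N z) 1.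
  exists (fun=> 0); apply: sder_near_eq (sder_cst 0 z).
  apply: filterS (near_norm_lt z1) => y /ltW y1.
  by rewrite /bump smoothstep0.
have z0 : z != 0.
  apply: contraTneq z1 => ->; have [_ hom _ _] := eN.
  by rewrite -(scale0r 0) hom normr0 mul0r -ltNge.
have [A sA] := sder_smoothstep (N z).
by eexists; exact: (sder_comp (sder_norm z0) sA).
Qed.

(* The functionals are indexed by the countable family of balls, so that a
   single sequence of functionals serves every point. *)
Lemma bump_functionals : exists (L : nat -> nat -> E -> R),
  (forall k i, blin (L k i)) /\
  forall z, exists k m, exists2 r : R, 0 < r & forall v, `|v| < r ->
    (forall i, (i < m)%N -> L k i v = 0) -> bump (z + v) = bump z.
Proof.
pose good k (L : nat -> E -> R) (m : nat) := (forall i, blin (L i)) /\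
  forall x y, `|x - q k| < rho k -> `|y - q k| < rho k ->
    (forall i, (i < m)%N -> L i x = L i y) -> N x = N y.
have LP k : exists Lm : (nat -> E -> R) * nat,
   (forall i, blin (Lm.1 i)) /\ ((exists L m, good k L m) -> good k Lm.1 Lm.2).
  have [[L [m g]]|ng] := pselect (exists L m, good k L m).
    by exists (L, m); split => //; exact: g.1.
  by exists (fun _ _ => 0, 0%N); split => // i; exact: blin_cst0.
pose L k := (projT1 (cid (LP k))).1; pose m k := (projT1 (cid (LP k))).2.
have [L1 L2] : (forall k i, blin (L k i)) /\
    (forall k, (exists L' m', good k L' m') -> good k (L k) (m k)).
  by split=> k; rewrite /L /m; case: cid => Lm [].
exists L; split => // z.
have [z1|z1] := ltP (N z) 1.
  have /near_ballP[r r0 hr] := near_norm_lt z1.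
  exists 0%N, 0%N, r => // v vr _; rewrite /bump !smoothstep0 // ltW //.
  by apply: hr; rewrite (addrC z) addrK.
have z0 : z != 0.
  apply: contraTneq z1 => ->; have [_ hom _ _] := eN.
  by rewrite -(scale0r 0) hom normr0 mul0r -ltNge.
have [l [V [L' [gam [oV Vz lL' hN]]]]] := lN z0.
have /near_ballP[r r0 hr] : \forall y \near z, V y by exact: open_nbhs_nbhs.
have r2 : 0 < r / 2 by rewrite divr_gt0.
have [k [zk kr]] := dens z r2 ltr01; rewrite mul1r in zk.
have /L2[_ gk] : exists L m, good k L m.
  (* The finite list [L'] is padded with zero functionals into a sequence; the length [l] is kept
     separately. *)
  exists (fun i => if insub i is Some j then L' j else fun=> 0), l; split.
    move=> i; case: insubP => [j _ _|_]; last exact: blin_cst0.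
    have [lin cont] := lL' j.
    pose lA := GRing.isLinear.Build R E R _ (L' j) lin.
    pose A : {linear E -> R} := HB.pack (L' j) lA.
    exact: (@blin_linear _ _ _ A).
  move=> x y xk yk h.
  have inV w : `|w - q k| < rho k -> V w.
    move=> wk; apply: hr; rewrite -(subrK (q k) w) -addrA.
    by rewrite (splitr r) (le_lt_trans (ler_normD _ _)) // ltrD // ?(lt_trans wk) // distrC (lt_trans zk).
  rewrite (hN _ (inV _ xk)) (hN _ (inV _ yk)); congr gam; apply/funext => i.
  by have := h i (ltn_ord i); rewrite (valK i).
exists k, (m k), (rho k - `|z - q k|); first by rewrite subr_gt0.
move=> v vr hv; rewrite /bump; congr smoothstep; apply: gk => //.
  by rewrite addrAC addrC (le_lt_trans (ler_normD _ _)) // -ltrBrDr.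
by move=> i im; rewrite (blinD _ _ (L1 k i)) hv // addr0.
Qed.

Lemma bumpP : exists (a b M : R), [/\ 0 < a, 0 < b, 0 < M &
  [/\ forall z, 0 <= bump z <= 1, forall z, `|z| <= a -> bump z = 0,
    forall z, b <= `|z| -> bump z = 1 &
    forall x y, `|bump x - bump y| <= M * `|x - y|]].
Proof.
have [C C0 [NC lip]] := norm_lip.
have [_ _ _ [c [C' [c0 _ cC]]]] := eN.
(* The step is 0 for [N z <= 1] and 1 for [N z >= 2]; [c] and [C] translate these thresholds to the
   given norm, and 4 is the Lipschitz constant of the step. *)
exists C^-1, (2 / c), (4 * C); split; rewrite ?invr_gt0 ?divr_gt0 ?mulr_gt0 //.
split.
- by move=> z; rewrite smoothstep_ge0 smoothstep_le1.
- by move=> z h; apply: smoothstep0; rewrite (le_trans (NC z)) // -ler_pdivlMl // mulr1.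
- by move=> z; rewrite ler_pdivrMr // mulrC => h; apply: smoothstep1; rewrite (le_trans h) // (cC z).1.
- by move=> x y; rewrite (le_trans (smoothstep_lip _ _)) // -mulrA ler_pM2l.
Qed.

End bump.

(** * The locally finite-rank map *)

Section finite_rank_retraction.
Set Implicit Arguments. Unset Strict Implicit.
Context {R : realType} {E : normedModType R}.
Variables (e : nat -> E) (c : nat -> E -> R) (K : R).
Hypothesis K0 : 0 < K.
Hypothesis bc : forall i, blin (c i).
Hypothesis ce : forall i j, c j (e i) = (i == j)%:R.
Hypothesis cP : forall x, series (fun n => c n x *: e n) @ \oo --> x.
Hypothesis hK : forall x n (t : nat -> R), (forall i, `|t i| <= 1) ->
  `|\sum_(i < n) t i *: (c i x *: e i)| <= K * `|x|.
Variables (beta : E -> R) (a b M : R).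
Hypothesis a0 : 0 < a.
Hypothesis b0 : 0 < b.
Hypothesis M0 : 0 < M.
Hypothesis beta_sder : forall z, exists A, sder beta z A.
Hypothesis beta01 : forall z, 0 <= beta z <= 1.
Hypothesis beta_near0 : forall z, `|z| <= a -> beta z = 0.
Hypothesis beta_far : forall z, b <= `|z| -> beta z = 1.
Hypothesis beta_lip : forall x y, `|beta x - beta y| <= M * `|x - y|.

Definition head n x := \sum_(i < n) c i x *: e i.
(** [tail k] still contains the coordinate of index [k]: a bound on it therefore controls the [k]-th
    term of the multiplier sums. *)
Definition tail n x := x - head n x.

Lemma blin_tail n : blin (tail n).
Proof.
apply: blin_add; first exact: blin_id.
apply/blin_opp/(@blin_sum _ _ _ n (fun i x => c i x *: e i)) => k _.
exact: blin_scalel.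
Qed.

Lemma tail_le n x : `|tail n x| <= (1 + K) * `|x|.
Proof.
rewrite /tail (le_trans (ler_normB _ _)) // mulrDl mul1r lerD //.
rewrite /head (eq_bigr (fun i : 'I_n => 1 *: (c i x *: e i))) => [|i _].
  by apply: (hK x n (t := fun=> 1)) => i; rewrite normr1.
by rewrite scale1r.
Qed.

Lemma tail_cvg (x : E) (eps : R) : 0 < eps ->
  exists n, forall k, (n <= k)%N -> `|tail k x| < eps.
Proof.
move=> e0; have /cvg_seqP /(_ _ e0)[n hn] := @cP x.
by exists n => k /hn; rewrite /series /= big_mkord distrC.
Qed.

Lemma coef_head i n x : c i (head n x) = if (i < n)%N then c i x else 0.
Proof.
elim: n => [|n ih]; first by rewrite /head big_ord0 (blin0 (bc i)).
rewrite /head big_ord_recr /= (blinD _ _ (bc i)) ih (blinZ _ _ (bc i)) ce ltnS.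
case: ltngtP => [lt|gt|->]; rewrite ?mulr1 ?add0r //.
- by rewrite -[c n x *: _]/(c n x * _) mulr0 addr0.
- by rewrite -[c n x *: _]/(c n x * _) mulr0.
- by rewrite -[c n x *: _]/(c n x * _) mulr1.
Qed.

Lemma coef_tail i n x : c i (tail n x) = if (i < n)%N then 0 else c i x.
Proof.
by rewrite (blinB _ _ (bc i)) coef_head; case: ifP => _; rewrite ?subrr ?subr0.
Qed.

(* The first index m with t m != 0 bounds everything: coefficients before m
   are not seen by t, so the multiplier acts on tail m x, which is small. *)
Lemma multiplier_tail x n (t : nat -> R) (B : R) : 0 < B ->
  (forall k, `|t k| <= B) -> (forall k, t k != 0 -> `|tail k x| <= b) ->
  `|\sum_(k < n) t k *: (c k x *: e k)| <= K * B * b.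
Proof.
move=> B0 tB tb.
have [ex|nex] := pselect (exists k, t k != 0); last first.
  rewrite big1 ?normr0 => [|k _]; first by rewrite !mulr_ge0 // ltW.
  have [->|tk] := eqVneq (t k) 0; first by rewrite scale0r.
  by exfalso; apply: nex; exists (val k).
case: (ex_minnP ex) => m tm mmin.
have -> : \sum_(k < n) t k *: (c k x *: e k) =
    B *: \sum_(k < n) (t k / B) *: (c k (tail m x) *: e k).
  rewrite scaler_sumr; apply: eq_bigr => k _; rewrite [RHS]scalerA mulrCA divff ?gt_eqF // mulr1.
  rewrite coef_tail; case: ltnP => // km.
  have [->|tk] := eqVneq (t k) 0; first by rewrite !scale0r.
  by have := mmin _ tk; rewrite leqNgt km.
rewrite normrZ gtr0_norm // mulrAC mulrC ler_wpM2r ?(ltW B0) //.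
apply: (@le_trans _ _ (K * `|tail m x|)).
  apply: (hK (tail m x) n (t := fun k => t k / B)) => i.
  by rewrite normrM normfV (gtr0_norm B0) ler_pdivrMr // mul1r.
by rewrite ler_wpM2l ?(ltW K0) // tb.
Qed.

Definition cut_term k x := beta (tail k x) *: (c k x *: e k).
Definition cut := lfsum cut_term.

(** All tails are Lipschitz with the same constant [1 + K], so their pointwise convergence to 0
    gives smallness on a whole neighbourhood. *)
Lemma tail_near (x : E) : exists n, \forall y \near x, forall k, (n <= k)%N -> `|tail k y| <= a.
Proof.
have a2 : 0 < a / 2 by rewrite divr_gt0.
have [n hn] := tail_cvg x a2; exists n; apply/near_ballP.
have K1 : 0 < 1 + K by rewrite addr_gt0.
exists (a / 2 / (1 + K)); first by rewrite divr_gt0.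
move=> y; rewrite ltr_pdivlMr // mulrC => yx k nk.
rewrite -(subrK x y) (blinD _ _ (blin_tail k)) (le_trans (ler_normD _ _)) //.
by rewrite (splitr a) lerD // ltW ?hn // (le_lt_trans (tail_le _ _)).
Qed.

Lemma cut_termE0 k x : `|tail k x| <= a -> cut_term k x = 0.
Proof. by move=> h; rewrite /cut_term beta_near0 // scale0r. Qed.

Lemma cutE x n : (forall k, (n <= k)%N -> `|tail k x| <= a) ->
  cut x = \sum_(k < n) cut_term k x.
Proof. by move=> h; apply: lfsumE => k nk; apply: cut_termE0; exact: h. Qed.

(** The terms with the derivative of [beta] form a multiplier, depending on [h], acting on the
    coordinates of [x]; it vanishes when the tail exceeds [b], so [multiplier_tail] applies. The
    other terms multiply the coordinates of [h] by numbers in [0, 1]. *)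
Lemma cut_sder (x : E) : exists2 D, sder cut x D &
  forall h, `|D h| <= (K * (M * (1 + K)) * b + K) * `|h|.
Proof.
have [n hn] := tail_near x.
pose A k := projT1 (cid (beta_sder (tail k x))).
have sA k : sder beta (tail k x) (A k) by rewrite /A; case: cid.
have A_le k h : `|A k h| <= M * `|h|.
  by apply: (sder_bound (sA k)) => //; [exact: ltW|exists 1].
have A0 k : b < `|tail k x| -> A k = fun=> 0.
  move=> lt; apply: (sder_unique (sA k)).
  apply: (@sder_near_eq R E R (fun=> 1) beta _ _ _ (sder_cst (1 : R) (tail k x))).
  apply/near_ballP; exists (`|tail k x| - b); first by rewrite subr_gt0.
  move=> y yx; rewrite beta_far //.
  have := lerB_normD (tail k x) (y - tail k x); rewrite (addrC (tail k x)) subrK; lra.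
pose T k h := A k (tail k h) *: (c k x *: e k) + beta (tail k x) *: (c k h *: e k).
exists (fun h => \sum_(k < n) T k h).
  apply: (@sder_near_eq _ _ _ (fun y => \sum_(k < n) cut_term k y)).
    by apply: filterS hn => y /cutE.
  apply: (sder_sum (A := T)) => k _.
  apply: (sderZ (f := fun y => c k y *: e k)).
    exact: sder_comp (sder_lin x (blin_tail k)) (sA k).
  exact/sder_lin/blin_scalel.
(* Treated apart because [multiplier_tail] needs a strictly positive bound on the multiplier. *)
move=> h; have [->|h0] := eqVneq h 0.
  rewrite normr0 mulr0 big1 ?normr0 // => k _.
  rewrite /T (blin0 (blin_tail k)) (blin0 (sA k).1) scale0r add0r.
  by rewrite (blin0 (bc k)) scale0r scaler0.
rewrite big_split /= (le_trans (ler_normD _ _)) // mulrDl lerD //.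
  rewrite mulrAC -[K * _ * _]mulrA.
  apply: (@multiplier_tail x n (fun k => A k (tail k h))).
  - by rewrite !mulr_gt0 ?normr_gt0 // addr_gt0.
  - by move=> k; rewrite (le_trans (A_le _ _)) // -mulrA ler_pM2l // tail_le.
  - by move=> k; apply: contraNT; rewrite -ltNge => /A0 ->.
apply: (hK h n (t := fun k => beta (tail k x))) => k.
by have /andP[? ?] := beta01 (tail k x); rewrite ger0_norm.
Qed.

(** The multipliers [1 - beta] vanish where the tail is at least [b], so [multiplier_tail] applies
    with bound 1; the remaining [tail n x] is at most [a]. *)
Lemma cut_close (x : E) : `|cut x - x| <= K * 1 * b + a.
Proof.
have [n /nbhs_singleton hn] := tail_near x.
have -> : cut x - x = - (\sum_(k < n) (1 - beta (tail k x)) *: (c k x *: e k) + tail n x).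
  rewrite (cutE hn) -[tail n x]/(x - head n x).
  have -> : \sum_(k < n) (1 - beta (tail k x)) *: (c k x *: e k) =
      head n x - \sum_(k < n) cut_term k x.
    by rewrite /head -sumrB; apply: eq_bigr => k _; rewrite scalerBl scale1r.
  by rewrite [head n x - _ + _]addrC addrA subrK opprB.
rewrite normrN (le_trans (ler_normD _ _)) // lerD ?hn //.
apply: (@multiplier_tail x n (fun k => 1 - beta (tail k x))) => // k.
  by have /andP[? ?] := beta01 (tail k x); rewrite ger0_norm ?subr_ge0 // gerBl.
by apply: contraNT; rewrite -ltNge => /ltW /beta_far ->; rewrite subrr.
Qed.

(** Once [v] has no coordinates below [n], each [tail k (x + v)] with [k < n] is [tail k x + v], so
    invariance of [beta] at finitely many points is enough. *)
Lemma cut_invariant (F : nat -> E -> R) (x : E) :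
  (forall i, wnear F (fun v => c i v = 0)) ->
  (forall z, wnear F (fun v => beta (z + v) = beta z)) ->
  wnear F (fun v => cut (x + v) = cut x).
Proof.
move=> Fc Fb; have [n hn] := tail_near x.
have h1 := wnear_shift F hn.
have h2 : wnear F (fun v => forall k, (k < n)%N -> c k v = 0).
  exact: wnear_forall.
have h3 : wnear F (fun v => forall k, (k < n)%N -> beta (tail k x + v) = beta (tail k x)).
  exact: (wnear_forall (P := fun k v => beta (tail k x + v) = beta (tail k x))).
apply: filterS3 h1 h2 h3 => v v1 v2 v3.
rewrite (cutE v1) (cutE (nbhs_singleton hn)); apply: eq_bigr => k _.
rewrite /cut_term (blinD _ _ (bc k)) v2 // addr0; congr (_ *: _).
rewrite (blinD _ _ (blin_tail k)) -[RHS]v3 //; congr (beta (_ + _)).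
rewrite /tail /head big1 ?subr0 // => i _.
by rewrite v2 ?scale0r // (ltn_trans (ltn_ord i)).
Qed.

End finite_rank_retraction.

(** * A surjection on finite-codimensional subspaces *)

Section surjection_on_finite_codimension.
Set Implicit Arguments. Unset Strict Implicit.
Context {R : realType} {E : normedModType R}.
Variables (e : nat -> E) (c : nat -> E -> R) (K : R).
Hypothesis K0 : 0 < K.
Hypothesis bc : forall i, blin (c i).
Hypothesis ce : forall i j, c j (e i) = (i == j)%:R.
Hypothesis hK : forall x n (t : nat -> R), (forall i, `|t i| <= 1) ->
  `|\sum_(i < n) t i *: (c i x *: e i)| <= K * `|x|.

Lemma basis_vec_gt0 l : 0 < `|e l|.
Proof.
rewrite normr_gt0; apply/eqP => e0; have := ce l l.
by rewrite e0 (blin0 (bc l)) eqxx => /eqP; rewrite eq_sym oner_eq0.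
Qed.

Lemma coef_le l x : `|e l| * `|c l x| <= K * `|x|.
Proof.
have h := @hK x l.+1 (fun i => (i == l)%:R).
rewrite mulrC -normrZ (_ : c l x *: e l = \sum_(i < l.+1) (val i == l)%:R *: (c i x *: e i)).
  by apply: h => i; case: eqP => _; rewrite ?normr1 ?normr0.
rewrite (bigD1 ord_max) //= eqxx scale1r big1 ?addr0 // => i il.
by rewrite (_ : (val i == l) = false) ?scale0r //; apply/negbTE; apply: contra il => /eqP il; apply/eqP/val_inj.
Qed.

(** The factor [2^-1 ^+ l] makes the series converge absolutely, since the coordinate times the norm
    of [e l] is bounded by [coef_le]. The boolean [s] selects the coordinates that count. *)
Definition weight (s : nat -> bool) (x : E) l : R :=
  (s l)%:R * (2^-1 ^+ l * `|e l|) * c l x.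

Definition weighted_sum s x := limn (series (weight s x)).

Lemma weight_le s x l : `|weight s x l| <= geometric (K * `|x|) 2^-1 l.
Proof.
rewrite /weight /geometric /= !normrM normr_id (@ger0_norm _ (2^-1 ^+ l)) ?exprn_ge0 ?invr_ge0 //.
have h : 2^-1 ^+ l * `|e l| * `|c l x| <= K * `|x| * 2^-1 ^+ l.
  by rewrite -mulrA mulrC ler_wpM2r ?exprn_ge0 ?invr_ge0 // coef_le.
case: (s l); first by rewrite normr1 mul1r.
by rewrite normr0 !mul0r mulr_ge0 ?exprn_ge0 ?invr_ge0 // mulr_ge0 // ltW.
Qed.

Lemma half_lt1 : `|2^-1 : R| < 1.
Proof. by rewrite gtr0_norm ?invr_gt0 // invf_lt1 // ltr1n. Qed.

Lemma weight_cvg s x : cvgn (series (weight s x)).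
Proof.
apply: normed_cvg; apply: (@series_le_cvg _ _ (geometric (K * `|x|) 2^-1)).
- by move=> n; exact: normr_ge0.
- by move=> n; apply: le_trans (weight_le s x n).
- by move=> n; exact: weight_le.
- by apply: is_cvg_geometric_series; exact: half_lt1.
Qed.

Lemma weighted_sum_blin s : blin (weighted_sum s).
Proof.
split=> [a u v|].
  apply: cvg_lim => //.
  have -> : series (weight s (a *: u + v)) =
      a *: series (weight s u) + series (weight s v).
    apply/funext => n; rewrite /series !fctE /= scaler_sumr -big_split /=.
    apply: eq_bigr => l _; rewrite /weight (bc l).1 mulrDr; congr (_ + _).
    by rewrite -![_ *: _]/(_ * _) mulrCA.
  by apply: cvgD; [apply: cvgZr|]; exact: weight_cvg.
exists (K * 2) => [|x]; first by rewrite mulr_ge0 // ltW.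
apply: (@cvg_norm_le R R (series (weight s x))); first exact: weight_cvg.
move=> n; rewrite /series /=.
apply: (le_trans (ler_norm_sum _ _ _)).
apply: (@le_trans _ _ (series (geometric (K * `|x|) 2^-1) n)).
  by rewrite /series /=; apply: ler_sum => l _; exact: weight_le.
rewrite geometric_seriesE; last by rewrite lt_eqF // invf_lt1 // ltr1n.
have -> : 1 - 2^-1 = 2^-1 :> R by field.
rewrite invrK /=.
have y0 : 0 <= (2^-1 : R) ^+ n by rewrite exprn_ge0 // invr_ge0.
move: (2^-1 ^+ n) y0 => y y0.
have : 0 <= K * `|x| * y by rewrite !mulr_ge0 // ltW.
by lra.
Qed.

Lemma weighted_sum_single (s : nat -> bool) x p : (forall l, l != p -> s l -> c l x = 0) ->
  weighted_sum s x = weight s x p.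
Proof.
move=> h; apply: cvg_lim => //; apply/cvg_seqP => eps e0.
exists p.+1 => n pn; rewrite /series /= big_mkord (bigD1 (Ordinal pn)) //= big1.
  by rewrite addr0 subrr normr0.
move=> i ip; rewrite /weight.
have [si|] := boolP (s i); last by rewrite !mul0r.
by rewrite h ?mulr0.
Qed.

Variable F : nat -> E -> R.
Hypothesis bF : forall i, blin (F i).

(* k functionals have a common zero in the span of the k + 1 basis vectors
   of index k^2, ..., k^2 + k; these blocks are disjoint. *)
Lemma block_vector k : exists (v : E) (p : nat),
  [/\ forall j, (j < k)%N -> F j v = 0, c p v != 0 &
      forall l, c l v != 0 -> (k * k <= l <= k * k + k)%N].
Proof.
pose A := \matrix_(i < k.+1, j < k) F j (e (k * k + i)).
have kA : kermx A != 0.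
  rewrite kermx_eq0 /row_free; apply/eqP => rA.
  by have := rank_leq_col A; rewrite rA ltnn.
have /rowV0Pn[u /sub_kermxP uA u0] := kA.
pose v := \sum_(i < k.+1) u ord0 i *: e (k * k + i).
have cv (g : E -> R) : blin g -> g v = \sum_(i < k.+1) u ord0 i * g (e (k * k + i)).
  move=> bg; rewrite /v; elim/big_ind2: _ => [|x x' y y' <- <-|i _].
  - exact: blin0.
  - exact: blinD.
  - exact: blinZ.
have [i ui] : exists i, u ord0 i != 0.
  apply: contrapT => /forallNP h; move/eqP: u0; apply; apply/rowP => i.
  by rewrite mxE; apply/eqP/negP => /negP; exact: h.
have cl l : c l v = \sum_(i < k.+1) u ord0 i * (k * k + i == l)%N%:R.
  by rewrite cv //; apply: eq_bigr => j _; rewrite ce.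
exists v, (k * k + i)%N; split.
- move=> j jk; rewrite cv //.
  have /rowP/(_ (Ordinal jk)) := uA; rewrite !mxE => uAj.
  rewrite -[RHS]uAj; by apply: eq_bigr => l _; rewrite mxE.
- rewrite cl (bigD1 i) //= eqxx mulr1 big1 ?addr0 // => j ji.
  by rewrite eqn_add2l (_ : (val j == i) = false) ?mulr0 //; apply/negbTE.
- move=> l; apply: contraNT => lk; rewrite cl big1 // => j _.
  case: eqP => [jl|_]; last by rewrite mulr0.
  by move: lk; rewrite -jl leq_addr leq_add2l -ltnS ltn_ord.
Qed.

Lemma blocks_disjoint k k' l : (k * k <= l <= k * k + k)%N ->
  (k' * k' <= l <= k' * k' + k')%N -> k = k'.
Proof.
move=> /andP[h1 h2] /andP[h3 h4].
(* The next block starts at the square of [m + 1], beyond [m * m + m]. *)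
have aux m m' : (m * m <= l <= m * m + m)%N -> (m' * m' <= l)%N -> (m' <= m)%N.
  move=> /andP[_ g2] g3; rewrite leqNgt; apply/negP => lt.
  have : (m.+1 * m.+1 <= m * m + m)%N by rewrite (leq_trans _ (leq_trans g3 g2)) // leq_mul.
  by rewrite mulSn mulnS [X in (_ <= X)%N]addnC -[X in (_ <= X)%N]add0n leq_add2r.
by apply/eqP; rewrite eqn_leq (aux k' k) ?h1 ?h3 ?(aux k k') ?h1 ?h3.
Qed.

(** Block [k] has a vector killed by the first [k] functionals, with a nonzero pivot coordinate.
    Component [j] of [T] reads the pivots of the blocks with [k] congruent to [j] modulo [d], so [T]
    sends that vector to a nonzero multiple of a unit vector, and each unit vector is reached from
    arbitrarily late blocks. *)
Lemma surjection_on_finite_codim d : exists2 T : E -> 'rV[R]_d, blin T &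
  forall n (w : 'rV[R]_d), exists2 v, (forall i, (i < n)%N -> F i v = 0) & T v = w.
Proof.
pose v k := projT1 (cid (block_vector k)).
have vP k : exists p, [/\ forall j, (j < k)%N -> F j (v k) = 0, c p (v k) != 0 &
      forall l, c l (v k) != 0 -> (k * k <= l <= k * k + k)%N].
  by rewrite /v; case: cid.
pose p k := projT1 (cid (vP k)).
have pP k : [/\ forall j, (j < k)%N -> F j (v k) = 0, c (p k) (v k) != 0 &
      forall l, c l (v k) != 0 -> (k * k <= l <= k * k + k)%N].
  by rewrite /p; case: cid.
pose s (j : 'I_d) l := `[< exists2 k, (k %% d)%N = j & l = p k >].
pose T x : 'rV[R]_d := \row_j weighted_sum (s j) x.
have bT : blin T.
  split=> [a x y|].
    by apply/rowP => j; rewrite !mxE (weighted_sum_blin (s j)).1.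
  have [M M0 hM] : exists2 M : R, 0 <= M & forall j x, `|weighted_sum (s j) x| <= M * `|x|.
    pose M j := sval (cid2 (weighted_sum_blin (s j)).2).
    have MP j : 0 <= M j /\ forall x, `|weighted_sum (s j) x| <= M j * `|x|.
      by rewrite /M; case: cid2.
    exists (\sum_j M j) => [|j x]; first by apply: sumr_ge0 => j _; exact: (MP j).1.
    rewrite (le_trans ((MP j).2 x)) // ler_wpM2r // (bigD1 j) //= lerDl.
    by apply: sumr_ge0 => i _; exact: (MP i).1.
  exists M => // x; apply: mx_norm_leP => [|i j]; first by rewrite mulr_ge0.
  by rewrite mxE.
exists T => // n w.
have p_inj k k' : c (p k') (v k) != 0 -> k' = k.
  move=> h; have [_ _ b] := pP k; have [_ h' b'] := pP k'.
  exact: blocks_disjoint (b' _ h') (b _ h).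
pose tau k := (2^-1 ^+ p k * `|e (p k)|) * c (p k) (v k) : R.
have tau0 k : tau k != 0.
  have [_ h _] := pP k.
  by rewrite !mulf_neq0 // ?gt_eqF ?basis_vec_gt0 // exprn_gt0 // invr_gt0.
have Tv k j : T (v k) ord0 j = (k %% d == j)%N%:R * tau k.
  rewrite mxE (@weighted_sum_single _ _ (p k)) => [|l lp /asboolP[k' kj lk]].
    rewrite /weight /tau -mulrA; congr (_%:R * _); congr nat_of_bool.
    apply/asboolP/eqP => [[k' kj pk]|kj]; last by exists k.
    by rewrite -kj; congr (_ %% _)%N; apply/esym/p_inj; rewrite -pk; have [] := pP k.
  apply/eqP; apply: contraNT lp; rewrite lk => /p_inj ->; exact: eqxx.
(* A block with residue [j], of index at least [n] because [d] is positive once [j] exists. *)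
pose kk (j : 'I_d) := (n * d + j)%N.
have kkd j : (kk j %% d)%N = j by rewrite modnMDl modn_small.
pose a (j : 'I_d) := w ord0 j / tau (kk j).
exists (\sum_j a j *: v (kk j)) => [i im|].
  elim/big_ind: _ => [|x y hx hy|j _]; first exact: blin0.
    by rewrite (blinD _ _ (bF i)) hx hy addr0.
  rewrite (blinZ _ _ (bF i)); have [-> //] := pP (kk j); first by rewrite scaler0.
  apply: (leq_trans im); rewrite (@leq_trans (n * d)) ?leq_addr // leq_pmulr //.
  exact: leq_ltn_trans (ltn_ord j).
apply/rowP => j.
have -> : T (\sum_j a j *: v (kk j)) = \sum_j a j *: T (v (kk j)).
  elim/big_ind2: _ => [|x x' y y' <- <-|i _].
  - exact: blin0.
  - exact: blinD.
  - exact: blinZ.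
rewrite summxE (bigD1 j) //= big1 ?addr0 => [|i ij].
  by rewrite mxE Tv kkd eqxx mul1r /a divfK.
by rewrite mxE Tv kkd (_ : (val i == j) = false) ?mul0r ?mulr0 //; apply/negbTE.
Qed.

End surjection_on_finite_codimension.

(** * Gluing the patches *)

Section perturbation.
Set Implicit Arguments. Unset Strict Implicit.
Context {R : realType} {E : normedModType R} {d : nat}.
Variables (q : nat -> E) (rho : nat -> R).
Hypothesis rho0 : forall k, 0 < rho k.
Hypothesis dens : forall (x : E) (r s : R), 0 < r -> 0 < s -> exists k,
      `|x - q k| < s * rho k /\ rho k < r.
Variables (beta : E -> R) (a b M : R).
Hypothesis a0 : 0 < a.
Hypothesis b0 : 0 < b.
Hypothesis M0 : 0 < M.
Hypothesis beta_sder : forall z, exists A, sder beta z A.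
Hypothesis beta01 : forall z, 0 <= beta z <= 1.
Hypothesis beta_near0 : forall z, `|z| <= a -> beta z = 0.
Hypothesis beta_far : forall z, b <= `|z| -> beta z = 1.
Hypothesis beta_lip : forall x y, `|beta x - beta y| <= M * `|x - y|.
Variables (Psi : E -> E) (kap C0 : R).
Hypothesis kap0 : 0 < kap.
Hypothesis C00 : 0 < C0.
Hypothesis Psi_sder : forall x, exists2 B, sder Psi x B & forall h, `|B h| <= kap * `|h|.
Hypothesis Psi_close : forall x, `|Psi x - x| <= C0.
Variables (f : E -> 'rV[R]_d) (U : set E) (D : E -> E -> 'rV[R]_d) (ef : E -> R).
Hypothesis sf : forall x, U x -> sder f x (D x).
Hypothesis oU : open U.
Hypothesis cD : forall x, U x -> forall eta : R, 0 < eta ->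
  \forall y \near x, forall h, `|D y h - D x h| <= eta * `|h|.
Hypothesis ef_loc : forall x, U x -> exists2 e0 : R, 0 < e0 & \forall y \near x, e0 <= ef y.

(** Chosen so that [eta * (1 + kap)] is 1/4, half of the derivative error allowed to a patch. *)
Definition eta : R := (4 * (kap + 1))^-1.

Lemma eta_gt0 : 0 < eta.
Proof. by rewrite invr_gt0 mulr_gt0 // addr_gt0. Qed.

Definition good k (e0 : R) := 0 < e0 /\ forall y, `|y - q k| < rho k ->
  [/\ U y, e0 <= ef y & forall z, `|z - q k| < rho k ->
    forall h, `|D y h - D z h| <= eta * e0 * `|h|].

Definition is_good k := exists e0, good k e0.

Definition low k : R := if pselect (is_good k) is left p then projT1 (cid p) else 1.

Lemma low_gt0 k : 0 < low k.
Proof. by rewrite /low; case: pselect => // p; case: cid => e0 []. Qed.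

Lemma lowP k : is_good k -> good k (low k).
Proof. by rewrite /low; case: pselect => // p _; case: cid. Qed.

(** Take a ball of radius below [r / 2] around a centre very close to [x]: it stays within [r] of
    [x], where [ef] is bounded below and the derivative oscillates little. *)
Lemma good_cover x (s : R) : U x -> 0 < s ->
  exists k, is_good k /\ `|x - q k| < s * rho k.
Proof.
move=> Ux s0; have [e0 e00 he] := ef_loc Ux.
have t0 : 0 < eta * e0 / 2 by rewrite divr_gt0 // mulr_gt0 // eta_gt0.
have /near_ballP[r r0 hr] : \forall y \near x, [/\ U y, e0 <= ef y &
    forall h, `|D y h - D x h| <= eta * e0 / 2 * `|h|].
  have h1 : \forall y \near x, U y by exact: open_nbhs_nbhs.
  by apply: filterS3 h1 he (cD Ux t0) => y.
have r2 : 0 < r / 2 by rewrite divr_gt0.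
have s1 : 0 < Num.min s 1 by rewrite lt_min s0 ltr01.
have [k [xk kr]] := dens x r2 s1.
have inb y : `|y - q k| < rho k -> `|y - x| < r.
  move=> yk; rewrite -(subrK (q k) y) -addrA (splitr r).
  rewrite (le_lt_trans (ler_normD _ _)) // ltrD // ?(lt_trans yk) //.
  rewrite distrC (lt_trans xk) // (le_lt_trans _ kr) // ler_piMl ?(ltW (rho0 k)) //.
  by rewrite ge_min lexx orbT.
exists k; split; last first.
  by rewrite (lt_le_trans xk) // ler_wpM2r ?(ltW (rho0 k)) // ge_min lexx.
exists e0; split => // y /inb yx; have [Uy ey Dy] := hr _ yx.
split => // z /inb zx h; have [_ _ Dz] := hr _ zx.
rewrite -(subrK (D x h) (D y h)) -addrA (le_trans (ler_normD _ _)) //.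
rewrite [X in _ + X]distrC (splitr (eta * e0)) mulrDl lerD //.
Qed.

(** The factor [4 * b / rho k] puts the support within [rho k / 4]. The patch is controlled up to
    [rho k / 2], which leaves room for the displacement by [Psik] and lets the correction vanish
    around every point farther out. *)
Definition phi k x : R :=
  if pselect (is_good k) then 1 - beta ((4 * b / rho k) *: (x - q k)) else 0.
Definition phi_lip k : R := M * (4 * b / rho k).

Lemma scale_gt0 k : 0 < 4 * b / rho k.
Proof. by rewrite divr_gt0 // mulr_gt0. Qed.

Lemma phi_lip_ge0 k : 0 <= phi_lip k.
Proof. exact: mulr_ge0 (ltW M0) (ltW (scale_gt0 k)). Qed.

Lemma phi01 k x : 0 <= phi k x <= 1.
Proof.
rewrite /phi; case: pselect => ?; last by rewrite lexx ler01.
have /andP[h1 h2] := beta01 ((4 * b / rho k) *: (x - q k)).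
by rewrite subr_ge0 h2 gerBl h1.
Qed.

Lemma phi_supp k x : phi k x != 0 -> is_good k /\ `|x - q k| < rho k / 4.
Proof.
rewrite /phi; case: pselect => [g h|?]; last by rewrite eqxx.
split => //; rewrite ltNge; apply/negP => le; move: h; rewrite beta_far ?subrr ?eqxx //.
rewrite normrZ gtr0_norm ?scale_gt0 // mulrAC ler_pdivlMr //.
move: le; rewrite ler_pdivrMr // => le.
by have := ler_wpM2l (ltW b0) le; lra.
Qed.

Lemma phi_eq1 k x : is_good k -> `|x - q k| < a / (4 * b) * rho k -> phi k x = 1.
Proof.
move=> g le; rewrite /phi; case: pselect => // ?.
rewrite beta_near0 ?subr0 // normrZ gtr0_norm ?scale_gt0 //.
rewrite mulrAC ler_pdivrMr // -ler_pdivlMl ?mulr_gt0 //.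
by rewrite (le_trans (ltW le)) // [(_)^-1 * _]mulrC [leRHS]mulrAC.
Qed.

Lemma phi_sder k x : exists A, sder (phi k) x A.
Proof.
rewrite (_ : phi k = fun x => phi k x) //.
rewrite /phi; case: pselect => ?; last by exists (fun=> 0); exact: sder_cst.
have [A sA] := beta_sder ((4 * b / rho k) *: (x - q k)).
have h := sder_scale (4 * b / rho k) (sderB (sder_lin x (@blin_id R E)) (sder_cst (q k) x)).
by eexists; exact: (sderB (sder_cst (1 : R) x) (sder_comp h sA)).
Qed.

Lemma onem_sub (u v : R) : 1 - u - (1 - v) = v - u.
Proof. by ring. Qed.

Lemma phi_lipP k x y : `|phi k x - phi k y| <= phi_lip k * `|x - y|.
Proof.
rewrite /phi; case: pselect => ?; last first.
  by rewrite subrr normr0 mulr_ge0 // phi_lip_ge0.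
rewrite onem_sub (le_trans (beta_lip _ _)) //.
rewrite -scalerBr opprB addrA subrK normrZ (gtr0_norm (scale_gt0 k)) mulrA.
by rewrite [`|y - x|]distrC.
Qed.

Definition rem n x : R := \prod_(j < n) (1 - phi j x).
Definition psi k x : R := phi k x * rem k x.
Definition rem_lip n : R := \sum_(j < n) phi_lip j.

Lemma rem_lip_ge0 n : 0 <= rem_lip n.
Proof. by apply: sumr_ge0 => j _; exact: phi_lip_ge0. Qed.

Lemma remS n x : rem n.+1 x = rem n x * (1 - phi n x).
Proof. by rewrite /rem big_ord_recr. Qed.

Lemma rem01 n x : 0 <= rem n x <= 1.
Proof.
elim: n => [|n /andP[h1 h2]]; first by rewrite /rem big_ord0 ler01 lexx.
have /andP[p1 p2] := phi01 n x.
by rewrite remS mulr_ge0 ?subr_ge0 // mulr_ile1 ?subr_ge0 // gerBl.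
Qed.

Lemma psi_ge0 k x : 0 <= psi k x.
Proof. by have /andP[? _] := phi01 k x; have /andP[? _] := rem01 k x; rewrite mulr_ge0. Qed.

Lemma sum_psi n x : \sum_(k < n) psi k x = 1 - rem n x.
Proof.
elim: n => [|n ih]; first by rewrite big_ord0 /rem big_ord0 subrr.
by rewrite big_ord_recr /= ih remS /psi; ring.
Qed.

Lemma lip_mul (s t s' t' u v : R) : 0 <= s <= 1 -> 0 <= t' <= 1 ->
  `|s - s'| <= u -> `|t - t'| <= v -> `|s * t - s' * t'| <= u + v.
Proof.
move=> /andP[s0 s1] /andP[t0 t1] hu hv.
have -> : s * t - s' * t' = (s - s') * t' + s * (t - t') by ring.
rewrite (le_trans (ler_normD _ _)) // !normrM (ger0_norm s0) (ger0_norm t0) lerD //.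
  by rewrite (le_trans _ hu) // ler_piMr.
by rewrite (le_trans _ hv) // ler_piMl.
Qed.

Lemma rem_lipP n x y : `|rem n x - rem n y| <= rem_lip n * `|x - y|.
Proof.
elim: n => [|n ih]; first by rewrite /rem !big_ord0 subrr normr0 /rem_lip big_ord0 mul0r.
rewrite !remS /rem_lip big_ord_recr /= mulrDl lip_mul //.
- exact: rem01.
- by have /andP[? ?] := phi01 n y; rewrite subr_ge0 gerBl; apply/andP.
- by rewrite onem_sub distrC phi_lipP.
Qed.

Lemma psi_lipP k x y : `|psi k x - psi k y| <= rem_lip k.+1 * `|x - y|.
Proof.
rewrite /rem_lip big_ord_recr /= mulrDl [leRHS]addrC lip_mul //.
- exact: phi01.
- exact: rem01.
- exact: phi_lipP.
- exact: rem_lipP.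
Qed.

Lemma rem_sder n x : exists A, sder (rem n) x A.
Proof.
elim: n => [|n [A sA]].
  exists (fun=> 0); apply: (@sder_eqf R E R _ (rem 0) _ _ _ (sder_cst (1 : R) x)) => y.
  by rewrite /rem big_ord0.
have [B sB] := phi_sder n x.
have h := sderZ sA (sderB (sder_cst (1 : R) x) sB).
eexists; apply: (@sder_eqf R E R _ (rem n.+1) _ _ _ h) => y.
by rewrite remS.
Qed.

Lemma psi_sder k x : exists2 A, sder (psi k) x A & forall h, `|A h| <= rem_lip k.+1 * `|h|.
Proof.
have [A sA] := phi_sder k x; have [B sB] := rem_sder k x.
have h : sder (psi k) x _ := sderZ sA sB.
eexists; first exact: h.
apply: sder_bound h _ _.
  exact: rem_lip_ge0.
by exists 1 => // y z _ _; exact: psi_lipP.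
Qed.

Lemma psi_phi k x : psi k x != 0 -> phi k x != 0.
Proof. by apply: contraNN => /eqP h; rewrite /psi h mul0r. Qed.

Lemma psi_near x : U x -> exists n, \forall y \near x,
  (forall k, (n <= k)%N -> psi k y = 0) /\ \sum_(k < n) psi k y = 1.
Proof.
move=> Ux; have ab : 0 < a / (4 * b) by rewrite divr_gt0 // mulr_gt0.
have [j [gj xj]] := good_cover Ux ab.
exists j.+1; apply/near_ballP.
exists (a / (4 * b) * rho j - `|x - q j|); first by rewrite subr_gt0.
move=> y yx; have p1 : phi j y = 1.
  apply: phi_eq1 => //; rewrite -(subrK x y) -addrA.
  by rewrite (le_lt_trans (ler_normD _ _)) // -ltrBrDr.
have r0 k : (j < k)%N -> rem k y = 0.
  by move=> jk; rewrite /rem (bigD1 (Ordinal jk)) //= p1 subrr mul0r.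
split=> [k jk|]; first by rewrite /psi r0 ?mulr0.
by rewrite sum_psi r0 ?subr0.
Qed.

(** * The patches and their error budget *)

Variables (T : E -> 'rV[R]_d) (MT : R).
Hypothesis bT : blin T.
Hypothesis MT0 : 0 <= MT.
Hypothesis hT : forall h, `|T h| <= MT * `|h|.

Definition lin_part k : E -> 'rV[R]_d := if pselect (is_good k) then D (q k) else fun=> 0.

Lemma q_in k : is_good k -> U (q k).
Proof. by move=> /lowP[_ /(_ (q k))]; rewrite subrr normr0 => /(_ (rho0 k))[]. Qed.

Lemma lin_part_blin k : blin (lin_part k).
Proof.
rewrite /lin_part; case: pselect => [g|?]; last exact: blin_cst0.
exact: (sf (q_in g)).1.
Qed.

(** Dividing by the Lipschitz constant of [psi k] makes the term with its derivative at most
    [low k * 2^-1 ^+ k.+2]; these powers sum to at most 1/2. *)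
Definition tol k : R := low k * 2^-1 ^+ k.+2 / (1 + rem_lip k.+1).

Lemma tol_gt0 k : 0 < tol k.
Proof.
apply: divr_gt0; last by rewrite ltr_wpDr // rem_lip_ge0.
by rewrite mulr_gt0 ?low_gt0 // exprn_gt0 // invr_gt0.
Qed.

Lemma tol_mul k : tol k * rem_lip k.+1 <= low k * 2^-1 ^+ k.+2.
Proof.
rewrite /tol -mulrA ler_piMr //.
  by rewrite mulr_ge0 ?exprn_ge0 ?invr_ge0 // ltW // low_gt0.
have := rem_lip_ge0 k.+1 => h.
by rewrite mulrC ler_pdivrMr ?ltr_wpDr // mul1r lerDr.
Qed.

Lemma tol_le k : tol k <= low k.
Proof.
have h := rem_lip_ge0 k.+1.
rewrite /tol ler_pdivrMr ?ltr_wpDr // ler_wpM2l ?(ltW (low_gt0 k)) //.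
rewrite (@le_trans _ _ 1) ?lerDl // exprn_ile1 ?invr_ge0 //.
by rewrite invf_le1 // ler1n.
Qed.

(** [Psik] moves points by at most [dl k * C0]: the first bound keeps the half ball inside the ball,
    the second limits the resulting change of [f - A] to [tol k / 2]. *)
Definition dl k : R := Num.min (rho k / 2) (tol k / 2 / (eta * low k)) / C0.
(** The first bound keeps the added multiple of [T] below [tol k / 2] on the ball, the second keeps
    its derivative below [low k / 4]. *)
Definition cf k : R := Num.min (tol k / 2 / (MT * (`|q k| + rho k) + 1)) (low k / 4 / (MT + 1)).

Lemma dl_gt0 k : 0 < dl k.
Proof.
have h1 : 0 < tol k / 2 / (eta * low k).
  apply: divr_gt0; first by apply: divr_gt0 => //; exact: tol_gt0.
  by apply: mulr_gt0; [exact: eta_gt0|exact: low_gt0].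
by rewrite divr_gt0 // lt_min h1 divr_gt0.
Qed.

Lemma dl1 k : dl k * C0 <= rho k / 2.
Proof. by rewrite /dl divfK ?gt_eqF // ge_min lexx. Qed.

Lemma dl2 k : eta * low k * (dl k * C0) <= tol k / 2.
Proof.
rewrite /dl divfK ?gt_eqF // mulrC -ler_pdivlMr ?mulr_gt0 ?eta_gt0 ?low_gt0 //.
by rewrite ge_min lexx orbT.
Qed.

Lemma cf_gt0 k : 0 < cf k.
Proof.
have h : 0 <= MT * (`|q k| + rho k) by rewrite mulr_ge0 // addr_ge0 // ltW.
rewrite lt_min; apply/andP; split; apply: divr_gt0.
- by apply: divr_gt0 => //; exact: tol_gt0.
- by rewrite ltr_wpDl.
- by rewrite divr_gt0 // low_gt0.
- by rewrite ltr_wpDl.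
Qed.

Lemma cf1 k : cf k * (MT * (`|q k| + rho k)) <= tol k / 2.
Proof.
have h : 0 <= MT * (`|q k| + rho k) by rewrite mulr_ge0 // addr_ge0 // ltW.
apply: (@le_trans _ _ (cf k * (MT * (`|q k| + rho k) + 1))).
  by rewrite ler_wpM2l ?(ltW (cf_gt0 k)) // lerDl.
by rewrite -ler_pdivlMr ?ltr_wpDl // ge_min lexx.
Qed.

Lemma cf2 k : cf k * MT <= low k / 4.
Proof.
apply: (@le_trans _ _ (cf k * (MT + 1))).
  by rewrite ler_wpM2l ?(ltW (cf_gt0 k)) // lerDl.
by rewrite -ler_pdivlMr ?ltr_wpDl // ge_min lexx orbT.
Qed.

Definition Psik k y := dl k *: Psi ((dl k)^-1 *: y).

Lemma Psik_close k y : `|Psik k y - y| <= dl k * C0.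
Proof.
have h := dl_gt0 k.
rewrite -{2}[y](scalerKV (lt0r_neq0 h)) -scalerBr normrZ gtr0_norm //.
by rewrite ler_pM2l.
Qed.

Lemma Psik_sder k y : exists2 B, sder (Psik k) y B & forall h, `|B h| <= kap * `|h|.
Proof.
have [B sB hB] := Psi_sder ((dl k)^-1 *: y).
have h := dl_gt0 k.
have s1 := sder_scale (dl k)^-1 (sder_lin y (@blin_id R E)).
eexists; first exact: (sder_scale (dl k) (sder_comp s1 sB)).
move=> w /=; rewrite normrZ gtr0_norm // (le_trans (ler_wpM2l (ltW h) (hB _))) //.
by rewrite normrZ gtr0_norm ?invr_gt0 // mulrCA mulVKf // gt_eqF.
Qed.

Definition patch k y := lin_part k y + (f (Psik k y) - lin_part k (Psik k y)) + cf k *: T y.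

Hypothesis mv : forall (x y z : E) (r e : R) (B : E -> 'rV[R]_d), 0 <= e ->
  (forall u, `|u - x| < r -> U u /\ forall h, `|D u h - B h| <= e * `|h|) ->
  `|y - x| < r -> `|z - x| < r -> `|f y - f z - B (y - z)| <= e * `|y - z|.

Lemma Psik_ball k y : `|y - q k| < rho k / 2 -> `|Psik k y - q k| < rho k.
Proof.
move=> yk; rewrite -(subrK y (Psik k y)) -addrA (le_lt_trans (ler_normD _ _)) //.
rewrite (splitr (rho k)) ler_ltD // (le_trans (Psik_close _ _)) //.
exact: dl1.
Qed.

Lemma patch_near k y : is_good k -> `|y - q k| < rho k / 2 ->
  `|patch k y - f y| <= tol k.
Proof.
move=> g yk; have [l0 hl] := lowP g.
have yk' : `|y - q k| < rho k.
  by rewrite (lt_trans yk) // ltr_pdivrMr // ltr_pMr // ltr1n.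
have bA := lin_part_blin k.
have -> : patch k y - f y =
    (f (Psik k y) - f y - lin_part k (Psik k y - y)) + cf k *: T y.
  rewrite /patch (blinB _ _ bA) addrAC; congr (_ + _).
  by rewrite opprB [RHS]addrACA !addrA [RHS]addrAC (addrC (lin_part k y)).

rewrite (splitr (tol k)) (le_trans (ler_normD _ _)) // lerD //.
  apply: (@le_trans _ _ (eta * low k * `|Psik k y - y|)).
    apply: (@mv (q k) _ _ (rho k)) => //.
    - by rewrite mulr_ge0 // ltW ?eta_gt0.
    - move=> u uk; have [Uu _ hu] := hl u uk; split => // h.
      rewrite /lin_part; case: pselect => // ?; apply: hu.
      by rewrite subrr normr0.
    - exact: Psik_ball.
  apply: le_trans (dl2 k); rewrite ler_wpM2l ?Psik_close //.
  by rewrite mulr_ge0 // ltW ?eta_gt0.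
rewrite normrZ gtr0_norm ?cf_gt0 // (le_trans _ (cf1 k)) //.
rewrite ler_wpM2l ?(ltW (cf_gt0 k)) // (le_trans (hT _)) // ler_wpM2l //.
rewrite -{1}(subrK (q k) y) (le_trans (ler_normD _ _)) // addrC lerD //.
exact: ltW.
Qed.

Lemma patch_sder k y : is_good k -> `|y - q k| < rho k / 2 ->
  exists2 B, sder (patch k) y B & forall h, `|B h - D y h| <= low k / 2 * `|h|.
Proof.
move=> g yk; have [l0 hl] := lowP g.
have yk' : `|y - q k| < rho k.
  by rewrite (lt_trans yk) // ltr_pdivrMr // ltr_pMr // ltr1n.
have bA := lin_part_blin k.
have [B sB hB] := Psik_sder k y.
have Pk := Psik_ball yk.
have [UP _ hP] := hl _ Pk.
have sP := sder_comp sB (sf UP).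
have sl := sder_comp sB (sder_lin (Psik k y) bA).
have sT := sder_scale (cf k) (sder_lin y bT).
have qk : `|q k - q k| < rho k by rewrite subrr normr0.
have lE : lin_part k = D (q k) by rewrite /lin_part; case: pselect.
eexists; first exact: (sderD (sderD (sder_lin y bA) (sderB sP sl)) sT).
move=> h /=.
have -> : lin_part k h + (D (Psik k y) (B h) - lin_part k (B h)) + cf k *: T h - D y h =
  (lin_part k h - D y h) + (D (Psik k y) (B h) - lin_part k (B h)) + cf k *: T h.
  by rewrite addrAC [lin_part k h + _ - _]addrAC.
have h1 : `|lin_part k h - D y h| <= eta * low k * `|h|.
  by rewrite lE; have [_ _ hq] := hl _ qk; exact: hq.
have h2 : `|D (Psik k y) (B h) - lin_part k (B h)| <= eta * low k * (kap * `|h|).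
  rewrite lE (le_trans (hP _ qk _)) // ler_wpM2l //.
  by rewrite mulr_ge0 // ltW ?eta_gt0.
have h3 : `|cf k *: T h| <= low k / 4 * `|h|.
  rewrite normrZ gtr0_norm ?cf_gt0 // (le_trans (ler_wpM2l (ltW (cf_gt0 k)) (hT h))) //.
  by rewrite mulrA ler_wpM2r // cf2.
(* By the choice of [eta], the first two errors add up to [low k / 4]; the multiple of [T] takes the
   other [low k / 4]. *)
have -> : low k / 2 * `|h| = (eta * low k * `|h| + eta * low k * (kap * `|h|)) + low k / 4 * `|h|.
  rewrite /eta; field.
  by rewrite gt_eqF // addr_gt0.
by rewrite (le_trans (ler_normD _ _)) // lerD // (le_trans (ler_normD _ _)) // lerD.
Qed.

(** Gluing differences to [f] makes each error estimate a bound on one term; where the [psi] sum to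
    1 the result is the usual combination of the patches. *)
Definition corr k y := psi k y *: (patch k y - f y).

Lemma psi_supp k x : psi k x != 0 -> is_good k /\ `|x - q k| < rho k / 4.
Proof. by move=> /psi_phi /phi_supp. Qed.

Lemma corr_le k x : U x -> `|corr k x| <= psi k x * ef x.
Proof.
move=> Ux; rewrite /corr normrZ (ger0_norm (psi_ge0 k x)).
have [->|p0] := eqVneq (psi k x) 0; first by rewrite !mul0r.
have [g xk] := psi_supp p0.
have x2 : `|x - q k| < rho k / 2.
  by rewrite (lt_le_trans xk) // ler_pM2l // lef_pV2 ?posrE // ler_nat.
have x1 : `|x - q k| < rho k.
  by rewrite (lt_trans x2) // ltr_pdivrMr // ltr_pMr // ltr1n.
rewrite ler_wpM2l ?psi_ge0 // (le_trans (patch_near g x2)) //.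
by rewrite (le_trans (tol_le k)) //; have [_ /(_ _ x1)[]] := lowP g.
Qed.

(** By the Leibniz rule, [tol_mul] bounds the term with the derivative of [psi k], and [patch_sder]
    the other. For a bad ball, or at distance at least [rho k / 2], the correction vanishes near
    [x]. *)
Lemma corr_sder k x : U x -> exists2 B, sder (corr k) x B &
  forall h, `|B h| <= (ef x * 2^-1 ^+ k.+2 + psi k x * (ef x / 2)) * `|h|.
Proof.
move=> Ux.
have ef0 : 0 <= ef x.
  by have [e0 e00 /nbhs_singleton] := ef_loc Ux; apply: le_trans; exact: ltW.
have trivial_case : (\forall y \near x, psi k y = 0) -> exists2 B, sder (corr k) x B &
  forall h, `|B h| <= (ef x * 2^-1 ^+ k.+2 + psi k x * (ef x / 2)) * `|h|.
  move=> h0; exists (fun=> 0).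
    apply: (@sder_near_eq R E _ (fun=> 0) (corr k) _ _ _ (sder_cst (0 : 'rV[R]_d) x)).
    by apply: filterS h0 => y h0; rewrite /corr h0 scale0r.
  move=> h; rewrite normr0; apply: mulr_ge0 => //.
  apply: addr_ge0; apply: mulr_ge0 => //; last by apply: divr_ge0.
  exact: psi_ge0.
have [g|ng] := pselect (is_good k); last first.
  apply: trivial_case; apply: nearW => y; apply/eqP; apply: contra_notT ng.
  by move=> /psi_supp[].
have [x2|x2] := ltP (`|x - q k|) (rho k / 2); last first.
  apply: trivial_case; apply/near_ballP; exists (rho k / 4); first by rewrite divr_gt0.
  move=> y yx; apply/eqP; apply: contraTT x2 => /psi_supp[_ yk].
  rewrite -ltNge -(subrK y x) -addrA (le_lt_trans (ler_normD _ _)) // distrC.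
  have -> : rho k / 2 = rho k / 4 + rho k / 4 by field.
  by rewrite ltrD.
have x1 : `|x - q k| < rho k.
  by rewrite (lt_trans x2) // ltr_pdivrMr // ltr_pMr // ltr1n.
have [_ /(_ _ x1)[_ le _]] := lowP g.
have [A sA hA] := psi_sder k x.
have [B sB hB] := patch_sder g x2.
eexists; first exact: (sderZ sA (sderB sB (sf Ux))).
move=> h /=; rewrite (le_trans (ler_normD _ _)) // mulrDl (normrZ (A h)) (normrZ (psi k x)) lerD //.
  apply: (@le_trans _ _ (rem_lip k.+1 * `|h| * tol k)).
    by rewrite ler_pM // patch_near.
  rewrite mulrC mulrA ler_wpM2r // (le_trans (tol_mul k)) //.
  by rewrite ler_wpM2r ?exprn_ge0 ?invr_ge0.
rewrite (ger0_norm (psi_ge0 k x)) -mulrA ler_wpM2l ?psi_ge0 //.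
by rewrite (le_trans (hB h)) // ler_wpM2r // ler_pM2r ?invr_gt0.
Qed.

Definition perturbed x := f x + lfsum corr x.

Lemma perturbed_near x : U x -> exists n, \forall y \near x,
  [/\ forall k, (n <= k)%N -> psi k y = 0, \sum_(k < n) psi k y = 1 &
  perturbed y = f y + \sum_(k < n) corr k y].
Proof.
move=> /psi_near[n hn]; exists n; apply: filterS hn => y [h1 h2]; split => //.
by rewrite /perturbed (lfsumE (n := n)) // => k nk; rewrite /corr h1 // scale0r.
Qed.

Lemma perturbed_close x : U x -> `|perturbed x - f x| <= ef x.
Proof.
move=> Ux; have [n /nbhs_singleton[_ h2 ->]] := perturbed_near Ux.
rewrite addrC addKr (le_trans (ler_norm_sum _ _ _)) //.
rewrite -[leRHS]mul1r -h2 mulr_suml; apply: ler_sum => k _; exact: corr_le.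
Qed.

Lemma sum_half n : \sum_(k < n) (2^-1 : R) ^+ k.+2 <= 2^-1.
Proof.
suff -> : \sum_(k < n) (2^-1 : R) ^+ k.+2 = 2^-1 - 2^-1 ^+ n.+1.
  by rewrite gerBl exprn_ge0 // invr_ge0.
elim: n => [|n ih]; first by rewrite big_ord0 expr1 subrr.
rewrite big_ord_recr /= ih !exprS; move: (2^-1 ^+ n) => y; lra.
Qed.

Lemma perturbed_sder x : U x -> exists2 B, sder perturbed x B &
  forall h, `|B h - D x h| <= ef x * `|h|.
Proof.
move=> Ux; have [n hn] := perturbed_near Ux.
have ef0 : 0 <= ef x.
  by have [e0 e00 /nbhs_singleton] := ef_loc Ux; apply: le_trans; exact: ltW.
pose B k := projT1 (cid2 (corr_sder k Ux)).
have BP k : sder (corr k) x (B k) /\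
    forall h, `|B k h| <= (ef x * 2^-1 ^+ k.+2 + psi k x * (ef x / 2)) * `|h|.
  by rewrite /B; case: cid2.
exists (fun h => D x h + \sum_(k < n) B k h).
  apply: (@sder_near_eq R E _ (fun y => f y + \sum_(k < n) corr k y)).
    by apply: filterS hn => y [_ _ ->].
  by apply: sderD; [exact: sf|apply: sder_sum => k _; exact: (BP k).1].
move=> h; rewrite addrC addKr (le_trans (ler_norm_sum _ _ _)) //.
apply: (@le_trans _ _ (\sum_(k < n) (ef x * 2^-1 ^+ k.+2 + psi k x * (ef x / 2)) * `|h|)).
  by apply: ler_sum => k _; exact: (BP k).2.
rewrite -mulr_suml ler_wpM2r // big_split /= -mulr_sumr -mulr_suml.
have [_ -> _] := nbhs_singleton hn; rewrite mul1r.
by rewrite [leRHS](splitr (ef x)) lerD // ler_wpM2l // sum_half.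
Qed.

(** * Surjectivity of the derivative along common kernels *)

Variable F : nat -> E -> R.
Hypothesis bF : forall i, blin (F i).
Hypothesis F_lin : forall k, wnear F (fun v => lin_part k v = 0).
Hypothesis F_beta : forall z, wnear F (fun v => beta (z + v) = beta z).
Hypothesis F_Psi : forall z, wnear F (fun v => Psi (z + v) = Psi z).
Hypothesis T_surj : forall n (w : 'rV[R]_d),
  exists2 v, (forall i, (i < n)%N -> F i v = 0) & T v = w.

Lemma phi_invariant k x : wnear F (fun v => phi k (x + v) = phi k x).
Proof.
rewrite /phi; case: pselect => ?; last exact: filterE.
apply: filterS (wnear_scale (4 * b / rho k) bF (F_beta ((4 * b / rho k) *: (x - q k)))) => v h.
by rewrite addrAC scalerDr h.
Qed.

Lemma Psik_invariant k x : wnear F (fun v => Psik k (x + v) = Psik k x).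
Proof.
apply: filterS (wnear_scale (dl k)^-1 bF (F_Psi ((dl k)^-1 *: x))) => v h.
by rewrite /Psik scalerDr h.
Qed.

(* Along the vectors v killed by finitely many of the functionals F i, only
   the linear term T varies. *)
Lemma perturbed_affine x : U x -> exists2 t : R, 0 < t &
  wnear F (fun v => perturbed (x + v) = perturbed x + t *: T v).
Proof.
move=> Ux; have [n hn] := perturbed_near Ux.
have patchE y : (forall k, (n <= k)%N -> psi k y = 0) -> \sum_(k < n) psi k y = 1 ->
    f y + \sum_(k < n) corr k y = \sum_(k < n) psi k y *: patch k y.
  move=> _ s1; rewrite -[f y in LHS]scale1r -s1 scaler_suml -big_split /=.
  by apply: eq_bigr => k _; rewrite /corr scalerBr addrC subrK.
have [p1 p2 p3] := nbhs_singleton hn.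
(* Positive because the weights are nonnegative with sum 1 and every [cf k] is positive. *)
exists (\sum_(k < n) psi k x * cf k).
  rewrite lt_neqAle; apply/andP; split; last first.
    by apply: sumr_ge0 => k _; rewrite mulr_ge0 ?psi_ge0 // ltW // cf_gt0.
  apply/eqP => /esym/eqP; rewrite psumr_eq0 => [|k _]; last first.
    by rewrite mulr_ge0 ?psi_ge0 // ltW // cf_gt0.
  move=> /allP h; have /eqP := p2; rewrite big1 => [|k _].
    by rewrite eq_sym oner_eq0.
  have := h k (mem_index_enum _); rewrite /= mulf_eq0 (gt_eqF (cf_gt0 k)) orbF.
  by move=> /eqP.
have h1 := wnear_shift F hn.
have h2 : wnear F (fun v => forall k, (k < n)%N -> phi k (x + v) = phi k x).
  by apply: (wnear_forall (P := fun k v => phi k (x + v) = phi k x)) => k _; exact: phi_invariant.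
have h3 : wnear F (fun v => forall k, (k < n)%N ->
    lin_part k v = 0 /\ Psik k (x + v) = Psik k x).
  apply: (wnear_forall (P := fun k v => lin_part k v = 0 /\ Psik k (x + v) = Psik k x)) => k _.
  by apply: filterI; [exact: F_lin|exact: Psik_invariant].
apply: filterS3 h1 h2 h3 => v [v1 v2 v3] hphi hlin.
rewrite v3 p3 !patchE // scaler_suml -big_split /=; apply: eq_bigr => k _.
have -> : psi k (x + v) = psi k x.
  rewrite /psi hphi // /rem; congr (_ * _); apply: eq_bigr => j _.
  by rewrite hphi // (ltn_trans (ltn_ord j)).
rewrite -scalerA -scalerDr; congr (_ *: _).
have [l1 l2] := hlin k (ltn_ord k).
rewrite /patch l2 (blinD _ _ (lin_part_blin k)) l1 addr0.
by rewrite (blinD _ _ bT) scalerDr addrA.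
Qed.

(** For [v] in the kernel with [t *: T v = w], a small increment [s *: v] changes the function by
    exactly [s *: w]; comparison with the derivative along [v] forces [B v = w]. *)
Lemma perturbed_surj x B : U x -> sder perturbed x B ->
  forall w, exists h, B h = w.
Proof.
move=> Ux sB w.
have [t t0 [n [r r0 hr]]] := perturbed_affine Ux.
have [v Fv Tv] := T_surj n (t^-1 *: w); exists v.
have tTv : t *: T v = w by rewrite Tv scalerA divff ?scale1r // gt_eqF.
apply/eqP; rewrite -subr_eq0 -normr_eq0; apply/eqP/le_anti.
rewrite normr_ge0 andbT; apply/ler_addgt0Pr => e e0; rewrite add0r.
have v1 : 0 < `|v| + 1 by rewrite ltr_wpDl.
have [p p0 hp] := sB.2 _ (divr_gt0 e0 v1).
pose s := Num.min r p / (`|v| + 1).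
have s0 : 0 < s by rewrite divr_gt0 // lt_min r0.
have sv : `|s *: v| < Num.min r p.
  rewrite normrZ gtr0_norm // /s mulrAC ltr_pdivrMr // ltr_pM2l ?ltrDl //.
  by rewrite lt_min r0.
clearbody s.
have [svr svp] : `|s *: v| < r /\ `|s *: v| < p.
  by move: sv; rewrite lt_min => /andP.
have := hp (x + s *: v) x; rewrite (addrC x) addrK subrr normr0 => /(_ svp p0).
rewrite (addrC _ x) hr // => [|i /Fv vi]; last by rewrite (blinZ _ _ (bF i)) vi scaler0.
rewrite (addrC (perturbed x)) addrK.
rewrite (blinZ _ _ bT) (blinZ _ _ sB.1) scalerA mulrC -scalerA tTv -scalerBr !normrZ.
rewrite gtr0_norm // mulrCA ler_pM2l // distrC => /le_trans; apply.
by rewrite mulrAC ler_pdivrMr // ler_pM2l // lerDl.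
Qed.

End perturbation.

Section enumeration.
Set Implicit Arguments. Unset Strict Implicit.
Context {R : realType} {E : normedModType R}.

Definition flatten_functionals (L : nat -> nat -> E -> R) m : E -> R :=
  if unpickle m is Some (k, i) then L k i else fun=> 0.

Lemma flatten_functionals_pickle L k i :
  flatten_functionals L (pickle (k, i)) = L k i.
Proof. by rewrite /flatten_functionals pickleK. Qed.

Lemma blin_flatten L m : (forall k i, blin (L k i)) -> blin (flatten_functionals L m).
Proof.
move=> h; rewrite /flatten_functionals; case: unpickle => [[k i]//|].
exact: blin_cst0.
Qed.

End enumeration.

Theorem theorem3p1 (R : realType) (E : completeNormedModType R) (e : nat -> E)
  (N : E -> R) (d : nat) (U : set E) (f : E -> 'rV[R]_d) (eps : E -> R) :
  unconditional_basis e ->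
  equivalent_norm N -> C1_away_origin N -> locally_finitely_many_coords N ->
  open U -> C1_on U f ->
  {within U, continuous eps} -> (forall x, U x -> 0 < eps x) ->
  exists g : E -> 'rV[R]_d,
    [/\ C1_on U g,
        forall x, U x -> enorm (f x - g x) <= eps x,
        forall x, U x -> forall h : E, enorm ('d f x h - 'd g x h) <= eps x * `|h| &
        forall x, U x -> forall v : 'rV[R]_d, exists h : E, 'd g x h = v].
Proof.
move=> ub eN cN lN oU cf ceps eps0.
have [c [K [K0 bc ce cP hK]]] := unconditional_basisP ub.
have [q [rho [rho0 dens]]] := dense_balls cP.
have bsder := bump_sder eN cN.
have [a [b [M [a0 b0 M0 [b01 bnear0 bfar blip]]]]] := bumpP eN.
have [L [bL hL]] := bump_functionals dens eN lN.
pose Psi := cut e c (bump N).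
pose kap := K * (M * (1 + K)) * b + K; pose C0 := K * 1 * b + a.
have kap0 : 0 < kap by rewrite addr_gt0 // !mulr_gt0 // addr_gt0.
have C00 : 0 < C0 by rewrite addr_gt0 // !mulr_gt0.
have Psi_sder x : exists2 B, sder Psi x B & forall h, `|B h| <= kap * `|h|.
  exact: (cut_sder K0 bc ce cP hK a0 b0 M0 bsder b01 bnear0 bfar blip x).
have Psi_close x : `|Psi x - x| <= C0.
  exact: (cut_close K0 bc ce cP hK a0 b0 b01 bnear0 bfar x).
have cD x : U x -> forall eta : R, 0 < eta ->
    \forall y \near x, forall h, `|'d f y h - 'd f x h| <= eta * `|h|.
  move=> Ux eta eta0; have [_ h] := cf _ Ux.
  by apply: filterS (h _ eta0) => y hy w; apply: le_trans (le_enorm _) (hy w).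
have sf x : U x -> sder f x ('d f x).
  move=> Ux; apply: sder_of_C1.
  - by move=> y z w t t0; exact: mean_value_rV.
  - have nU : \forall y \near x, U y by exact: open_nbhs_nbhs.
    by apply: filterS nU => y Uy; have [] := cf _ Uy.
  - exact: cD.
have d0 : 0 < d%:R + 1 :> R by rewrite ltr_wpDl.
(* Working tolerance for the maximum norm; multiplying by [d] on return to the Euclidean norm stays
   below [eps]. *)
pose ef x := eps x / (d%:R + 1).
have ef_loc x : U x -> exists2 e0 : R, 0 < e0 & \forall y \near x, e0 <= ef y.
  move=> Ux; exists (eps x / 2 / (d%:R + 1)).
    by rewrite !divr_gt0 // eps0.
  have cx : {for x, continuous eps}.
    by move: ceps; rewrite (continuous_open_subspace _ oU); apply; rewrite inE.
  have e2 : 0 < eps x / 2 by rewrite divr_gt0 // eps0.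
  move/cvgrPdist_lt : cx => /(_ _ e2); apply: filterS => y.
  by rewrite ltr_norml => /andP[_ h]; rewrite ler_pM2r ?invr_gt0 //; lra.
have efd x : U x -> d%:R * ef x <= eps x.
  move=> Ux; rewrite /ef mulrA ler_pdivrMr // mulrC ler_wpM2l ?lerDl //.
  by rewrite ltW // eps0.
pose A := lin_part q rho kap U (fun x => 'd f x) ef.
have bA k : blin (A k) by exact: (lin_part_blin _ rho0 _ _ sf).
pose Ac k j : E -> R := fun x => if insub j is Some j' then A k x ord0 (j' : 'I_d) else 0.
have bAc k j : blin (Ac k j).
  rewrite /Ac; case: insubP => [j' _ _|_]; last exact: blin_cst0.
  split=> [t u v|]; first by rewrite (bA k).1 !mxE.
  have [B B0 hB] := (bA k).2; exists B => // h.
  by apply: le_trans (hB h); exact: le_mx_norm.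
(* The three kinds of functionals are merged into one sequence by coding pairs. None depends on [T]
   or on the scales, so [T] can be built from [F] afterwards. *)
have [F [bF Fc FL FA]] : exists F : nat -> E -> R, [/\ forall i, blin (F i),
    forall i, wnear F (fun v => c i v = 0),
    forall k i, wnear F (fun v => L k i v = 0) &
    forall k i, wnear F (fun v => Ac k i v = 0)].
  pose H k i : E -> R := match k with
    | 0 => c i | 1 => flatten_functionals Ac i | k'.+2 => L k' i end.
  have HF k i : wnear (flatten_functionals H) (fun v => H k i v = 0).
    by have := wnear_killed (flatten_functionals H) (pickle (k, i));
       rewrite flatten_functionals_pickle.
  exists (flatten_functionals H); split.
  - move=> i; apply: blin_flatten => -[|[|k]] j //=.
    exact: blin_flatten.
  - exact: (HF 0%N).
  - by move=> k; exact: (HF k.+2).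
  - move=> k i; have := HF 1%N (pickle (k, i)).
    by rewrite /H flatten_functionals_pickle.
have F_lin k : wnear F (fun v => A k v = 0).
  have h := wnear_forall (P := fun i v => Ac k i v = 0) (n := d) (fun i _ => FA k i).
  apply: filterS h => v h; apply/rowP => j; have := h j (ltn_ord j).
  by rewrite /Ac valK mxE.
have F_beta z : wnear F (fun v => bump N (z + v) = bump N z).
  have [k [m [r r0 h]]] := hL z.
  have h1 := wnear_forall (P := fun i v => L k i v = 0) (n := m) (fun i _ => FL k i).
  have h2 : wnear F (fun v => `|v| < r).
    by apply: wnear_nbhs; apply/near_ballP; exists r => // y; rewrite subr0.
  by apply: filterS2 h1 h2 => v v1 v2; exact: h.
have F_Psi z : wnear F (fun v => Psi (z + v) = Psi z).
  exact: (cut_invariant K0 bc cP hK a0 bnear0 z Fc F_beta).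
have [T bT T_surj] := surjection_on_finite_codim K0 bc ce hK bF d.
have [MT MT0 hT] := bT.2.
have mv (x y z : E) (r t : R) (B : E -> 'rV[R]_d) : 0 <= t ->
    (forall u, `|u - x| < r -> U u /\ forall h, `|'d f u h - B h| <= t * `|h|) ->
    `|y - x| < r -> `|z - x| < r -> `|f y - f z - B (y - z)| <= t * `|y - z|.
  move=> t0 h yr zr; apply: mean_value_rV => [|s s01]; first by rewrite mulr_ge0.
  have [Us hs] := h _ (segment_ball yr zr s01).
  by split; [have [] := cf _ Us|exact: hs].
have [g [gs gc gsurj]] : exists g : E -> 'rV[R]_d,
    [/\ forall x, U x -> exists2 B, sder g x B &
          forall h, `|B h - 'd f x h| <= ef x * `|h|,
        forall x, U x -> `|g x - f x| <= ef x &
        forall x B, U x -> sder g x B -> forall w, exists h, B h = w].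
  exists (perturbed q rho (bump N) b M Psi kap C0 f U (fun x => 'd f x) ef T MT); split.
  - by move=> x; exact: (perturbed_sder rho0 dens a0 b0 M0 bsder b01 bnear0 bfar blip
      kap0 C00 Psi_sder Psi_close sf oU cD ef_loc bT MT0 hT mv).
  - by move=> x; exact: (perturbed_close rho0 dens a0 b0 M0 b01 bnear0 bfar
      kap0 C00 Psi_close sf oU cD ef_loc MT0 hT mv).
  - by move=> x B; exact: (perturbed_surj rho0 dens a0 b0 M0 b01 bnear0 kap0 sf oU
      cD ef_loc bT MT0 bF F_lin F_beta F_Psi T_surj).
have gd x : U x -> sder g x ('d g x).
  by move=> /gs[B sB _]; rewrite (sder_diff sB).2.
exists g; split.
- move=> x Ux; split; first exact: (sder_diff (gd x Ux)).1.
  move=> t t0; have t1 : 0 < t / (d%:R + 1) by rewrite divr_gt0.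
  apply: filterS (sder_C1 oU gd Ux t1) => y hy h.
  apply: le_trans (enorm_le _) _.
  apply: le_trans (ler_wpM2l _ (hy h)) _ => //.
  rewrite mulrA ler_wpM2r // mulrA ler_pdivrMr // mulrC ler_wpM2l ?lerDl //.
  exact: ltW.
- move=> x Ux; apply: le_trans (efd x Ux); apply: le_trans (enorm_le _) _.
  rewrite ler_wpM2l // distrC.
  exact: gc.
- move=> x Ux h; apply: (@le_trans _ _ (d%:R * ef x * `|h|)); last first.
    by rewrite ler_wpM2r // efd.
  rewrite -mulrA; apply: le_trans (enorm_le _) _; rewrite ler_wpM2l // distrC.
  by have [B sB] := gs x Ux; rewrite -(sder_diff sB).2; exact.
- by move=> x Ux v; exact: gsurj Ux (gd x Ux) v.
Qed.
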